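(* Let $d\ge 2$ and let $\boldsymbol{X}=(X_1,\dots,X_d)$ be a random vector with joint cdf $F_{\boldsymbol{X}}(\boldsymbol{x})=C(F_{X_1}(x_1),\dots,F_{X_d}(x_d))$, where each $F_{X_k}$, $k=1,\dots,d$, is the cdf of a mixed Erlang random variable, $F_{X_k}(x)=\sum_{j=1}^\infty q_{k,j}H(x;j,\beta)$ for $x\ge0$, with the same rate parameter $\beta>0$ for all $k$, and $C\in\mathcal{C}_d^{FGM}$. Let $\boldsymbol{I}$ be a symmetric multivariate Bernoulli random vector representing $C$, with pmf $f_{\boldsymbol{I}}$, and let $S=X_1+\dots+X_d$. For $m\in\{1,\dots,d\}$ and $s\ge0$, the expected allocation is given by $$E\left[X_m\times 1_{\{S=s\}}\right]=\sum_{\boldsymbol{i}\in\{0,1\}^d}f_{\boldsymbol{I}}(\boldsymbol{i})\left[\sum_{l=2}^{\infty}\sum_{\ell=1}^{l-1}\Pr\left(L_{m,\{i_m+1\}}=\ell\right)\Pr\left(\sum_{k=1,k\ne m}^{d}L_{k,\{i_k+1\}}=l-\ell\right)\frac{\ell}{2\beta}h(s;l+1,2\beta)\right].$$ Further, for $s\ge0$, $$E\left[X_m\times 1_{\{S>s\}}\right]=\sum_{\boldsymbol{i}\in\{0,1\}^d}f_{\boldsymbol{I}}(\boldsymbol{i})\left[\sum_{l=2}^{\infty}\sum_{\ell=1}^{l-1}\Pr\left(L_{m,\{i_m+1\}}=\ell\right)\Pr\left(\sum_{k=1,k\ne m}^{d}L_{k,\{i_k+1\}}=l-\ell\right)\f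rac{\ell}{2\beta}\overline{H}(s;l+1,2\beta)\right].$$
   Context: Erlang notation: for integer $\alpha\ge1$ and $\beta>0$, $h(x;\alpha,\beta)=\beta^\alpha x^{\alpha-1}e^{-\beta x}/(\alpha-1)!$ ($x\ge0$) is the pdf of the Erlang distribution with shape $\alpha$ and rate $\beta$, $H(x;\alpha,\beta)$ is its cdf and $\overline{H}=1-H$. In a mixed Erlang distribution, $(q_{k,j})_{j\ge1}$ is a probability vector (nonnegative entries summing to $1$). $\mathcal{C}_d^{FGM}$ is the class of $d$-variate Farlie-Gumbel-Morgenstern (FGM) copulas, that is, functions $$C(\boldsymbol{u})=\prod_{k=1}^d u_k\left(1+\sum_{k=2}^{d}\sum_{1\le j_1<\cdots<j_k\le d}\theta_{j_1\ldots j_k}\overline{u}_{j_1}\cdots\overline{u}_{j_k}\right),\quad \boldsymbol{u}\in[0,1]^d,\ \overline{u}_j=1-u_j,$$ whose real parameters satisfy $1+\sum_{k=2}^{d}\sum_{1\le j_1<\dots<j_k\le d}\theta_{j_1\dots j_k}\varepsilon_{j_1}\cdots\varepsilon_{j_k}\ge 0$ for all $(\varepsilon_1,\dots,\varepsilon_d)\in\{-1,1\}^d$. A symmetric multivariate Bernoulli random vector is a random vector $\boldsymbol{I}=(I_1,\dots,I_d)$ with values in $\{0,1\}^d$ such that $\Pr(I_k=0)=\Pr(I_k=1)=1/2$ for every $k$; $f_{\boldsymbol{I}}(\boldsymbol{i})=\Pr(\boldsymbol{I}=\boldsymbol{i})$. It represents $C$ if $$C(\boldsymbol{u})=E_{\boldsymbol{I}}\left[\prod_{k=1}^d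 F_{U_{[I_k+1]}}(u_k)\right],\quad \boldsymbol{u}\in[0,1]^d,$$ where $F_{U_{[1]}}(u)=1-(1-u)^2$ and $F_{U_{[2]}}(u)=u^2$. It is known that every $C\in\mathcal{C}_d^{FGM}$ is represented by such a vector. Let $Q_{k,j}=\sum_{n=1}^{j}q_{k,n}$ for $j\ge1$ and $Q_{k,0}=0$. For $k\in\{1,\dots,d\}$ and $i\in\{0,1\}$, $L_{k,\{i+1\}}$ is a random variable on $\{1,2,\dots\}$ with $\Pr(L_{k,\{i+1\}}=j)=q_{k,j,\{i+1\}}$, where $$q_{k,j,\{1\}}=\frac{1}{2^{j-1}}\sum_{n=0}^{j-1}\binom{j-1}{n}q_{k,n+1}(1-Q_{k,j-1-n}),\qquad q_{k,j,\{2\}}=\frac{1}{2^{j-1}}\sum_{n=0}^{j-1}\binom{j-1}{n}q_{k,n+1}Q_{k,j-1-n};$$ for each $\boldsymbol{i}\in\{0,1\}^d$, the variables $L_{1,\{i_1+1\}},\dots,L_{d,\{i_d+1\}}$ are taken independent. (These are the weights of the minimum and maximum of two independent copies of $X_k$ as mixed Erlang variables with rate $2\beta$.) The expected allocation is, by definition, $E[X_m\times1_{\{S=s\}}]=\int_0^s x\,f_{X_m,S_{-m}}(x,s-x)\,\mathrm{d}x$, $s\ge0$, where $S_{-m}=\sum_{k=1,k\ne m}^dX_k$ and $f_{X_m,S_{-m}}$ is the joint density of $(X_m,S_{-m})$ (its version continuous on $(0,\infty)^2$). $E[X_m\times 1_{\{S>s\}}]$ is an ordinary expectation. *)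

(* Defs.v *)
From HB Require Import structures.
From mathcomp Require Export all_boot all_order all_algebra.
From mathcomp Require Export all_classical all_reals all_analysis.

#[export] Set Implicit Arguments.
#[export] Unset Strict Implicit.
#[export] Unset Printing Implicit Defensive.

Export Order.TTheory GRing.Theory Num.Theory.
Export numFieldNormedType.Exports.

Local Open Scope classical_set_scope.
Local Open Scope ring_scope.

(* The shape [a] is meant to satisfy [1 <= a]; [erlang_pdf 0 b] is a junk value. *)
Definition erlang_pdf (R : realType) (a : nat) (b : R) : R -> R :=
  (fun x => b ^+ a * x ^+ a.-1 * expR (- (b * x)) / (a.-1)`!%:R) \_ `[0, +oo[.

Definition erlang_cdf (R : realType) (a : nat) (b x : R) : R :=
  \int[lebesgue_measure]_(t in `]-oo, x]) erlang_pdf a b t.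

Definition erlang_ccdf (R : realType) (a : nat) (b x : R) : R :=
  1 - erlang_cdf a b x.

(* Weight sequences are functions on [nat] used at indices [j >= 1] only: the
   value at 0 is unconstrained and never read. *)
Definition probability_weights (R : realType) (q : nat -> R) : Prop :=
  (forall j, (1 <= j)%N -> 0 <= q j) /\
  (\sum_(1 <= j <oo) (q j)%:E)%E = 1%E.

Definition cumul_weight (R : realType) (q : nat -> R) (j : nat) : R :=
  \sum_(1 <= n < j.+1) q n.

Definition min_weight (R : realType) (q : nat -> R) (j : nat) : R :=
  (2 ^+ j.-1)^-1 * \sum_(0 <= n < j)
     'C(j.-1, n)%:R * q n.+1 * (1 - cumul_weight q (j.-1 - n)).

Definition max_weight (R : realType) (q : nat -> R) (j : nat) : R :=
  (2 ^+ j.-1)^-1 * \sum_(0 <= n < j)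
     'C(j.-1, n)%:R * q n.+1 * cumul_weight q (j.-1 - n).

(* [false] stands for the Bernoulli value 0 (minimum of two independent copies)
   and [true] for the value 1 (maximum). *)
Definition order_weight (R : realType) (q : nat -> R) (b : bool) : nat -> R :=
  if b then max_weight q else min_weight q.

Definition order_unif_cdf (R : realType) (b : bool) (u : R) : R :=
  if b then u ^+ 2 else 1 - (1 - u) ^+ 2.

(* Sum over [2 <= k <= d] and [j_1 < ... < j_k] of
   [theta_(j_1 ... j_k) * v_(j_1) * ... * v_(j_k)]: an increasing list of
   indices is encoded by the set of its entries. *)
Definition fgm_sum (R : realType) (d : nat) (theta : {set 'I_d} -> R)
    (v : 'I_d -> R) : R :=
  \sum_(2 <= k < d.+1) \sum_(A : {set 'I_d} | #|A| == k)
     theta A * \prod_(j in A) v j.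

(* [C] is only constrained on the unit cube. *)
Definition fgm_copula (R : realType) (d : nat) (C : ('I_d -> R) -> R) : Prop :=
  exists theta : {set 'I_d} -> R,
    (forall eps : 'I_d -> R, (forall j, eps j = -1 \/ eps j = 1) ->
       0 <= 1 + fgm_sum theta eps) /\
    (forall u : 'I_d -> R, (forall j, 0 <= u j <= 1) ->
       C u = (\prod_(j < d) u j) * (1 + fgm_sum theta (fun j => 1 - u j))).

Definition symmetric_bernoulli (R : realType) (disp : measure_display)
    (T : measurableType disp) (P : probability T R) (d : nat)
    (I : 'I_d -> {RV P >-> bool}) : Prop :=
  forall k b, P [set w | I k w = b] = (2^-1)%:E.

Definition vector_pmf (R : realType) (disp : measure_display)
    (T : measurableType disp) (P : probability T R) (d : nat)
    (I : 'I_d -> {RV P >-> bool}) (i : 'I_d -> bool) : \bar R :=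
  P [set w | forall k, I k w = i k].

Definition represents (R : realType) (disp : measure_display)
    (T : measurableType disp) (P : probability T R) (d : nat)
    (I : 'I_d -> {RV P >-> bool}) (C : ('I_d -> R) -> R) : Prop :=
  forall u : 'I_d -> R, (forall j, 0 <= u j <= 1) ->
    ((C u)%:E =
     'E_P[fun w => (\prod_(k < d) order_unif_cdf (I k w) (u k))%R])%E.

Definition mutually_independent (R : realType)
    (disp disp' : measure_display) (T : measurableType disp)
    (T' : measurableType disp') (P : probability T R) (K : finType)
    (Y : K -> {RV P >-> T'}) : Prop :=
  forall (J : {set K}) (B : K -> set T'), (forall k, measurable (B k)) ->
    P [set w | forall k, k \in J -> B k (Y k w)] =
    (\prod_(k in J) P [set w | B k (Y k w)])%E.

Definition joint_density (R : realType) (disp : measure_display)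
    (T : measurableType disp) (P : probability T R) (Y Z : T -> R)
    (f : R * R -> R) : Prop :=
  [/\ measurable_fun setT f,
      forall p, 0 <= f p &
      forall A : set (R * R), measurable A ->
        P [set w | A (Y w, Z w)] =
        (\int[(@lebesgue_measure R) \x (@lebesgue_measure R)]_(p in A)
           (f p)%:E)%E].

(* A density is determined almost everywhere only; continuity on the open
   quadrant fixes its values there. *)
Definition continuous_joint_density (R : realType) (disp : measure_display)
    (T : measurableType disp) (P : probability T R) (Y Z : T -> R)
    (f : R * R -> R) : Prop :=
  joint_density P Y Z f /\
  (forall p : R * R, 0 < p.1 -> 0 < p.2 -> {for p, continuous f}).

(* Expected allocation [E[Y 1_{Y + Z = s}]], where [f] is the continuous joint
   density of [(Y, Z)]. *)
Definition expected_allocation (R : realType) (f : R * R -> R) (s : R)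
    : \bar R :=
  (\int[lebesgue_measure]_(x in `[0%R, s]) (x * f (x, s - x)%R)%:E)%E.

(* Main.v *)
Require Import Defs.
From HB Require Import structures.
From mathcomp Require Import all_boot all_order all_algebra.
From mathcomp Require Import all_classical all_reals all_analysis.
From mathcomp Require Import measurable_realfun.
From mathcomp Require Import ring lra.

(**
The copula [C] is the expectation over [I] of products of the functions
[order_unif_cdf], and these are the cdfs of the minimum and of the maximum of
two independent uniform variables.  Hence [X] is distributed as follows: draw
[I], then draw independent coordinates, the [k]-th one being the minimum
([I k] is false) or the maximum ([I k] is true) of two independent variables
with the law of [X k].

Such a minimum or maximum is mixed Erlang of rate [2 * beta], with the weights
[order_weight].  Indeed a mixed Erlang cdf is a Poisson series whose
coefficients are the partial sums of the weights; the product of two Poisson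
series of parameter [t] is one of parameter [2 * t], whose coefficients are
binomial averages, and Pascal's rule identifies the increments of these
([cumul_max_weight], [cumul_minmax_weight], [order_weight_cdf]).

The Erlang laws of a fixed rate form a convolution semigroup indexed by the
shape ([erlang_law_conv]).  Therefore, given [I], the sum of the [X k] with
[k != m] is again mixed Erlang, and its weights are the iterated convolution of
the weights of the summands.  The sum of the variables [L k] is governed by the
same convolution: the Dirac masses at the integers are another convolution
semigroup.  So one lemma on sums, [mixed_law_sum], applied to both semigroups,
shows that the law of [(X m, Sm)] is the mixture of the products of the Erlang
laws of shapes [n] and [l], with weights [vector_pmf I i] times the probability
that [L m (i m)] is [n] times the probability that the sum of the other
[L k (i k)] is [l].  Laws are identified from the joint cdf by changing one
coordinate at a time ([mixed_law_box]) and from rectangles ([pair_law]), so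
that only products of two measures occur.

Both formulas follow from this law and from the identity
[x * erlang_pdf n b x = n / b * erlang_pdf n.+1 b x]: weighting by [X m] raises
the shape of the first factor by one, and adding the two coordinates gives the
shape [n + l + 1].  For the first formula one needs the density itself.  It is
continuous on the open quadrant by dominated convergence, and any other density
with this property agrees with it there ([continuous_joint_density_le]); the
antidiagonal on which the allocation is computed leaves the open quadrant at
its two end points only.
*)

Local Open Scope classical_set_scope.
Local Open Scope ring_scope.

(** * Double series of nonnegative terms *)

Lemma nneseries_ltn (R : realType) (f : nat -> \bar R) (n : nat) :
  (forall i, 0 <= f i)%E ->
  (\sum_(0 <= i <oo) (if (i < n)%N then f i else 0) = \sum_(0 <= i < n) f i)%E.
Proof.
move=> f0; rewrite (@nneseries_split _ _ 0 n) ?add0n; last first.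
  by move=> k _; case: ifP.
rewrite [X in (_ + X)%E]eseries0 ?adde0; last first.
  by move=> i ni _; rewrite ltnNge ni.
rewrite !big_nat; apply: eq_bigr => i /andP[_ ->] //.
Qed.

(** The Cauchy rearrangement by antidiagonals; every regrouping of a double
    series in the sequel is an instance of it. *)
Lemma nneseries_diagonal (R : realType) (u : nat -> nat -> \bar R) :
  (forall i j, 0 <= u i j)%E ->
  (\sum_(0 <= i <oo) \sum_(0 <= j <oo) u i j =
   \sum_(0 <= n <oo) \sum_(0 <= i < n.+1) u i (n - i)%N)%E.
Proof.
move=> u0.
transitivity (\sum_(0 <= i <oo) \sum_(0 <= n <oo)
    (if (i < n.+1)%N then u i (n - i)%N else 0))%E.
  apply: eq_eseriesr => i _.
  rewrite -[RHS]eseries_mkcond.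
  rewrite [RHS](_ : _ = \sum_(i <= n <oo) u i (n - i)%N)%E; last first.
    by rewrite [RHS]eseries_cond.
  rewrite -(@nneseries_addn _ (fun n => u i (n - i)%N)); last by [].
  by apply: eq_eseriesr => n _; rewrite addnK.
rewrite nneseries_interchange; last by move=> i j; case: ifP.
apply: eq_eseriesr => n _; exact: (nneseries_ltn (f := fun i => u i (n - i)%N)).
Qed.

(** * Binomial averages and the weights of a minimum and a maximum *)

(** The weight of the Poisson term of index [N] and parameter [2 * t] in the
    product of two Poisson series with parameter [t] and coefficients [u] and [v].
    *)
Definition binomial_mean (R : realType) (u v : nat -> R) (N : nat) : R :=
  (2 ^+ N)^-1 * \sum_(0 <= i < N.+1) 'C(N, i)%:R * u i * v (N - i)%N.

(** Pascal's rule. *)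
Lemma binomial_meanS (R : realType) (u v : nat -> R) (N : nat) :
  binomial_mean u v N.+1 =
  2^-1 * (binomial_mean (u \o S) v N + binomial_mean u (v \o S) N).
Proof.
rewrite /binomial_mean -mulrDr mulrA -invfM -exprS; congr (_ * _).
rewrite big_nat_recl// bin0 mul1r subn0.
under eq_bigr => i _ do rewrite binS subSS natrD 2!mulrDl.
rewrite big_split/= addrA addrC; congr (_ + _).
rewrite big_nat_recr//= bin_small// !mul0r addr0.
rewrite [RHS]big_nat_recl// bin0 mul1r subn0; congr (_ + _).
rewrite !big_nat; apply: eq_bigr => i /andP[_ iN].
by rewrite -subSn// subSS.
Qed.

Lemma binomial_meanC (R : realType) (u v : nat -> R) (N : nat) :
  binomial_mean u v N = binomial_mean v u N.
Proof.
rewrite /binomial_mean; congr (_ * _).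
rewrite big_nat_rev/= !big_nat; apply: eq_bigr => i /andP[_ iN].
by rewrite add0n subSS bin_sub// subKn// mulrAC.
Qed.

Lemma binomial_meanD (R : realType) (u u' v : nat -> R) (N : nat) :
  binomial_mean (u \+ u') v N = binomial_mean u v N + binomial_mean u' v N.
Proof.
rewrite /binomial_mean -mulrDr -big_split/=; congr (_ * _).
by apply: eq_bigr => i _; rewrite mulrDr mulrDl.
Qed.

Lemma cumul_weight0 (R : realType) (q : nat -> R) : cumul_weight q 0 = 0.
Proof. by rewrite /cumul_weight big_geq. Qed.

Lemma cumul_weightS (R : realType) (q : nat -> R) (N : nat) :
  cumul_weight q N.+1 = cumul_weight q N + q N.+1.
Proof. by rewrite /cumul_weight big_nat_recr. Qed.

Lemma cumul_weight_shift (R : realType) (q : nat -> R) :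
  cumul_weight q \o S = cumul_weight q \+ (q \o S).
Proof. by apply/funext => N /=; rewrite cumul_weightS. Qed.

(** The coefficients of the square of a mixed Erlang cdf are the partial sums
    of [max_weight]: by Pascal's rule both sides have the increment [max_weight q
    N.+1], so no derivative of the cdf is needed. *)
Lemma cumul_max_weight (R : realType) (q : nat -> R) (N : nat) :
  cumul_weight (max_weight q) N =
  binomial_mean (cumul_weight q) (cumul_weight q) N.
Proof.
elim: N => [|N IH].
  by rewrite cumul_weight0 /binomial_mean big_nat1 cumul_weight0 !mulr0.
rewrite cumul_weightS IH binomial_meanS.
rewrite [X in _ * (_ + X)]binomial_meanC cumul_weight_shift binomial_meanD.
rewrite (_ : max_weight q N.+1 =
  binomial_mean (q \o S) (cumul_weight q) N)//.
by field.
Qed.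

(** The companion of [cumul_max_weight]: minimum and maximum together have the
    cdf [2 * F], which is read as [2 * F * 1] in order to have the parameter [2 *
    t]. *)
Lemma cumul_minmax_weight (R : realType) (q : nat -> R) (N : nat) :
  cumul_weight (min_weight q) N + cumul_weight (max_weight q) N =
  2 * binomial_mean (cumul_weight q) (fun=> 1) N.
Proof.
elim: N => [|N IH].
  by rewrite !cumul_weight0 /binomial_mean big_nat1 cumul_weight0 !(mulr0, mul0r) addr0.
rewrite !cumul_weightS addrACA IH binomial_meanS.
rewrite cumul_weight_shift binomial_meanD.
have -> : min_weight q N.+1 + max_weight q N.+1 =
  binomial_mean (q \o S) (fun=> 1) N.
  rewrite /min_weight /max_weight /binomial_mean/= -mulrDr -big_split/=.
  by congr (_ * _); apply: eq_bigr => i _; rewrite -mulrDr subrK mulr1.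
rewrite (_ : (fun=> 1) \o S = (fun=> 1))//.
by field.
Qed.

(** * Poisson weights and Erlang densities *)

Definition poisson_weight (R : realType) (t : R) (i : nat) : R :=
  expR (- t) * t ^+ i / i`!%:R.

Lemma poisson_weight_ge0 (R : realType) (t : R) (i : nat) :
  0 <= t -> 0 <= poisson_weight t i.
Proof. by move=> t0; rewrite /poisson_weight !mulr_ge0 ?expR_ge0 ?exprn_ge0. Qed.

(** The binomial thinning identity: two Poisson weights of parameter [t]
    multiply to a binomial share of a Poisson weight of parameter [2 * t]. This is
    where the rate doubles. *)
Lemma poisson_weight_mul (R : realType) (t : R) (N i : nat) : (i <= N)%N ->
  poisson_weight t i * poisson_weight t (N - i) =
  (2 ^+ N)^-1 * 'C(N, i)%:R * poisson_weight (2 * t) N.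
Proof.
move=> iN; rewrite /poisson_weight.
have -> : - (2 * t) = - t + - t by rewrite mulr_natl mulr2n opprD.
rewrite expRD exprMn -[in t ^+ N](subnKC iN) exprD -(bin_fact iN) !natrM.
have h2 : (2 ^+ N : R) != 0 by rewrite expf_neq0.
have hi : (i`!%:R : R) != 0 by rewrite pnatr_eq0 -lt0n fact_gt0.
have hj : ((N - i)`!%:R : R) != 0 by rewrite pnatr_eq0 -lt0n fact_gt0.
have hc : ('C(N, i)%:R : R) != 0 by rewrite pnatr_eq0 -lt0n bin_gt0.
by field; rewrite h2 hi hj hc.
Qed.

Lemma sum_poisson_weight (R : realType) (t : R) : 0 <= t ->
  (\sum_(0 <= i <oo) (poisson_weight t i)%:E = 1)%E.
Proof.
move=> t0.
under eq_eseriesr => i _ do rewrite /poisson_weight -mulrA EFinM.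
rewrite nneseriesZl; last by move=> i _; rewrite lee_fin divr_ge0 ?exprn_ge0.
rewrite (_ : (\sum_(0 <= i <oo) _)%E = (expR t)%:E).
  by rewrite -EFinM -expRD addNr expR0.
rewrite -EFin_lim ?/expR; last exact: is_cvg_series_exp_coeff.
by apply/congr_lim/funext => n /=; rewrite sumEFin.
Qed.

(** The exponential dominates its Taylor term of order [i + 1], so the weight
    of index [i] is at most [(i + 1) / t]. *)
Lemma cvg_poisson_weight (R : realType) (i : nat) :
  poisson_weight t i @[t --> (+oo : set_system R)] --> (0 : R).
Proof.
have h : (i.+1%:R * t^-1) @[t --> (+oo : set_system R)] --> (0 : R).
  rewrite -[X in _ --> X](mulr0 i.+1%:R); apply: cvgMr.
  apply/gtr0_cvgV0; last exact: cvg_id.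
  by near=> t; near: t; exact: nbhs_pinfty_gt.
apply: (squeeze_cvgr _ (cvg_cst 0) h).
near=> t.
have t0 : 0 < t by near: t; exact: nbhs_pinfty_gt.
rewrite (poisson_weight_ge0 _ (ltW t0))/= /poisson_weight expRN.
have := @expR_ge1Dxn _ t i (ltW t0).
rewrite factS natrM exprS => h1.
have h2 : t * t ^+ i / (i.+1%:R * i`!%:R) <= expR t.
  by apply: le_trans h1; rewrite lerDr.
have E0 := expR_gt0 t.
have hi : (i`!%:R : R) != 0 by rewrite pnatr_eq0 -lt0n fact_gt0.
rewrite -mulrA ler_pdivrMl// mulrCA -ler_pdivrMl ?ltr0n//.
rewrite ler_pdivlMr//; apply: le_trans h2.
rewrite le_eqVlt; apply/orP; left; apply/eqP.
by field; rewrite hi nat1r pnatr_eq0.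
Unshelve. all: by end_near. Qed.

Lemma is_derive_poisson_weight (R : realType) (b x : R) (n : nat) :
  is_derive x 1 (fun y => poisson_weight (b * y) n)
    (b * ((if n is k.+1 then poisson_weight (b * x) k else 0)
          - poisson_weight (b * x) n)).
Proof.
rewrite (_ : (fun y => _) = (n`!%:R^-1 * b ^+ n) *: ((expR \o (fun y => - b * y)) *
    ((@id R) ^+ n))); last first.
  apply/funext => y; rewrite /poisson_weight exprMn.
  by rewrite exprfctE !fctE/= /GRing.scale/= mulNr; ring.
have h : is_derive x 1 (fun y => - b * y) (- b).
  by have := @is_deriveZ _ _ _ (@id R) (- b) x 1 1 (is_derive_id _ _); rewrite [_ *: 1]mulr1.
have h2 := is_derive1_comp (is_derive_expR (- b * x)) h.
have h3 := is_deriveM h2 (is_deriveX n (is_derive_id x 1)).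
apply: (is_derive_eq (is_deriveZ (n`!%:R^-1 * b ^+ n) h3)).
rewrite /GRing.scale/= exprfctE mulNr /poisson_weight mulr1.
case: n {h3} => [|n].
  by rewrite fact0 invr1 /= !expr0; ring.
have hi : (n`!%:R : R) != 0 by rewrite pnatr_eq0 -lt0n fact_gt0.
rewrite factS natrM !exprMn !exprS /=; field.
by rewrite hi nat1r pnatr_eq0.
Qed.

(** The derivatives of consecutive Poisson weights telescope, so minus this sum
    is an antiderivative of an Erlang density. *)
Lemma is_derive_sum_poisson_weight (R : realType) (b x : R) (n : nat) :
  is_derive x 1 (fun y => \sum_(0 <= i < n.+1) poisson_weight (b * y) i)
    (- (b * poisson_weight (b * x) n)).
Proof.
elim: n => [|n IH].
  under eq_fun do rewrite big_nat1.
  by apply: (is_derive_eq (is_derive_poisson_weight b x 0)); rewrite sub0r mulrN.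
rewrite (_ : (fun y => _) =
  (fun y => \sum_(0 <= i < n.+1) poisson_weight (b * y) i) +
  (fun y => poisson_weight (b * y) n.+1)); last first.
  by apply/funext => y; rewrite [LHS]big_nat_recr.
apply: (is_derive_eq (is_deriveD IH (is_derive_poisson_weight b x n.+1))).
by rewrite mulrBr addKr.
Qed.

Lemma erlang_pdfE (R : realType) (b x : R) (n : nat) : 0 <= x ->
  erlang_pdf n.+1 b x = b * poisson_weight (b * x) n.
Proof.
move=> x0; rewrite /erlang_pdf patchE ifT; last by rewrite inE/= in_itv/= x0.
by rewrite /poisson_weight exprMn exprS; ring.
Qed.

Lemma erlang_pdf_lt0 (R : realType) (b x : R) (n : nat) : x < 0 ->
  erlang_pdf n b x = 0.
Proof.
move=> x0; rewrite /erlang_pdf patchE ifF//.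
by apply/negbTE; rewrite notin_setE/= in_itv/= andbT leNgt x0.
Qed.

Lemma erlang_pdf_ge0 (R : realType) (b x : R) (n : nat) : 0 <= b ->
  0 <= erlang_pdf n b x.
Proof.
move=> b0; rewrite /erlang_pdf; apply: restrict_ge0 => y; rewrite /= in_itv/= andbT => y0.
by rewrite !mulr_ge0 ?expR_ge0 ?exprn_ge0.
Qed.

Lemma continuous_poisson_weight (R : realType) (b : R) (n : nat) :
  continuous (fun x => poisson_weight (b * x) n).
Proof.
move=> x.
apply/differentiable_continuous/derivable1_diffP.
by have [] := is_derive_poisson_weight b x n.
Qed.

Lemma measurable_erlang_pdf (R : realType) (b : R) (n : nat) :
  measurable_fun [set: R] (erlang_pdf n b).
Proof.
apply/measurable_restrict => //; apply: measurable_funTS.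
apply: measurable_funM => //; apply: measurable_funM; last first.
  apply: measurableT_comp => //; apply: measurableT_comp => //.
  exact: measurable_funM.
Qed.

Lemma within_continuous_erlang_pdf (R : realType) (b : R) (n : nat) :
  {within `[0, +oo[, continuous (erlang_pdf n.+1 b)}.
Proof.
have h : {within `[0, +oo[, continuous (fun x => b * poisson_weight (b * x) n)}.
  apply: continuous_subspaceT => x.
  by apply: cvgM; [exact: cvg_cst|exact: continuous_poisson_weight].
apply: subspace_eq_continuous h => x.
by rewrite inE/= in_itv/= andbT => x0; rewrite /from_subspace/= erlang_pdfE.
Qed.

Lemma erlang_pdf_antiderivative (R : realType) (b x : R) (n : nat) : 0 <= x ->
  is_derive x 1 (fun y => - \sum_(0 <= i < n.+1) poisson_weight (b * y) i)
    (erlang_pdf n.+1 b x).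
Proof.
move=> x0; rewrite erlang_pdfE//.
by apply: (is_derive_eq (is_deriveN (is_derive_sum_poisson_weight b x n))); rewrite opprK.
Qed.

Lemma sum_poisson_weight0 (R : realType) (n : nat) :
  \sum_(0 <= i < n.+1) poisson_weight (0 : R) i = 1.
Proof.
rewrite big_nat_recl// big1_seq ?addr0.
  by rewrite /poisson_weight oppr0 expR0 expr0 fact0 mul1r invr1 mulr1.
by move=> i _; rewrite /poisson_weight expr0n/= mulr0 mul0r.
Qed.

Lemma continuous_sum_poisson_weight (R : realType) (b : R) (n : nat) :
  continuous (fun x => - \sum_(0 <= i < n.+1) poisson_weight (b * x) i).
Proof.
move=> x; apply/differentiable_continuous/derivable1_diffP.
by have [] := is_deriveN (is_derive_sum_poisson_weight b x n).
Qed.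

Lemma integral_erlang_pdf_restrict (R : realType) (b : R) (n : nat) (A : set R) :
  0 <= b -> measurable A ->
  (\int[lebesgue_measure]_(t in A) (erlang_pdf n b t)%:E =
   \int[lebesgue_measure]_(t in A `&` `[0%R, +oo[) (erlang_pdf n b t)%:E)%E.
Proof.
move=> b0 mA; rewrite [RHS]integral_mkcondr; apply: eq_integral => x xA.
rewrite patchE; case: ifPn => //; rewrite notin_setE/= in_itv/= andbT => /negP.
by rewrite -ltNge => x0; rewrite erlang_pdf_lt0.
Qed.

Lemma integral_erlang_pdf_itv (R : realType) (b x : R) (n : nat) :
  0 < b -> 0 <= x ->
  (\int[lebesgue_measure]_(t in `]-oo, x]) (erlang_pdf n.+1 b t)%:E =
   (1 - \sum_(0 <= i < n.+1) poisson_weight (b * x) i)%:E)%E.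
Proof.
move=> b0; rewrite le_eqVlt => /predU1P[<-|x0].
  rewrite mulr0 sum_poisson_weight0 subrr integral_erlang_pdf_restrict ?ltW//.
  rewrite (_ : _ `&` _ = [set 0]) ?integral_set1//.
  apply/seteqP; split => y /=; rewrite !in_itv/= andbT.
    by move=> [y0 y1]; apply/le_anti; rewrite y0 y1.
  by move=> ->; rewrite lexx.
rewrite integral_erlang_pdf_restrict ?ltW//.
rewrite (_ : _ `&` _ = `[0, x]%classic); last first.
  apply/seteqP; split => y /=; rewrite !in_itv/= andbT.
    by move=> [-> ->].
  by move=> /andP[-> ->].
rewrite (continuous_FTC2 x0 (F := fun y => - \sum_(0 <= i < n.+1) poisson_weight (b * y) i)).
- by rewrite mulr0 sum_poisson_weight0 -EFinB opprK addrC.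
- apply: (@continuous_subspaceW R^o _ _ [set` `[0, +oo[%R]).
    exact: subset_itvl.
  exact: within_continuous_erlang_pdf.
- split.
  + move=> y; rewrite in_itv/= => /andP[/ltW y0 _].
    by have [] := erlang_pdf_antiderivative b n y0.
  + by apply/cvg_at_right_filter; exact: continuous_sum_poisson_weight.
  + by apply/cvg_at_left_filter; exact: continuous_sum_poisson_weight.
- move=> y; rewrite in_itv/= => /andP[/ltW y0 _].
  by rewrite derive1E; have [] := erlang_pdf_antiderivative b n y0.
Qed.

Lemma integral_erlang_pdf (R : realType) (b : R) (n : nat) : 0 < b ->
  (\int[lebesgue_measure]_t (erlang_pdf n.+1 b t)%:E = 1)%E.
Proof.
move=> b0; rewrite integral_erlang_pdf_restrict ?ltW// setTI.
rewrite (@ge0_continuous_FTC2y _ _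
  (fun y => - \sum_(0 <= i < n.+1) poisson_weight (b * y) i) _ (- 0)).
- by rewrite mulr0 sum_poisson_weight0 -EFinB oppr0 opprK add0r.
- by move=> y _; exact/erlang_pdf_ge0/ltW.
- exact: within_continuous_erlang_pdf.
- apply: cvgN.
  elim: n.+1 => [|k IH].
    rewrite (_ : (fun x => _) = (fun=> 0)); first exact: cvg_cst.
    by apply/funext => x; rewrite big_geq.
  rewrite (_ : (fun x => _) =
    (fun x => \sum_(0 <= i < k) poisson_weight (b * x) i) +
    (fun x => poisson_weight (b * x) k)); last first.
    by apply/funext => x; rewrite [LHS]big_nat_recr.
  rewrite -[X in _ --> X](addr0 0); apply: cvgD => //.
  apply: (@cvg_comp _ _ _ (fun y => b * y) (fun t => poisson_weight t k)); last first.
    exact: cvg_poisson_weight.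
  by apply: gt0_cvgMry => //; exact: cvg_id.
- by move=> y /ltW y0; have [] := erlang_pdf_antiderivative b n y0.
- by apply/cvg_at_right_filter; exact: continuous_sum_poisson_weight.
- move=> y; rewrite in_itv/= => /andP[/ltW y0 _].
  by rewrite derive1E; have [] := erlang_pdf_antiderivative b n y0.
Qed.

(** * Erlang laws and their convolution *)

Import HBNNSimple.

(** True for indicators by definition, for simple functions by linearity, and
    in general by monotone convergence on both sides. *)
Lemma ge0_integral_density (d : measure_display) (T : measurableType d)
    (R : realType) (mu nu : {measure set T -> \bar R}) (h : T -> R)
    (f : T -> \bar R) :
  measurable_fun setT h -> (forall x, 0 <= h x) ->
  (forall A, measurable A -> nu A = \int[mu]_(x in A) (h x)%:E)%E ->
  measurable_fun setT f -> (forall x, 0 <= f x)%E ->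
  (\int[nu]_x f x = \int[mu]_x (f x * (h x)%:E))%E.
Proof.
move=> mh h0 nuE mf f0.
pose g := nnsfun_approx measurableT mf.
have gf x : (g n x)%:E @[n --> \oo] --> f x by exact: cvg_nnsfun_approx.
have nd_g x : {homo (fun n => g n x) : p q / (p <= q)%N >-> (p <= q)%R}.
  by move=> p q pq; exact/lefP/nd_nnsfun_approx.
rewrite (@nd_ge0_integral_lim _ _ _ nu f g f0 nd_g gf).
have simple n : sintegral nu (g n) = (\int[mu]_x ((g n x)%:E * (h x)%:E))%E.
  under eq_integral => x _ do rewrite fimfunE fsbig_finite//= -EFinM mulr_suml -sumEFin.
  rewrite sintegralE fsbig_finite//= ge0_integral_sum//; last 2 first.
  - move=> r; apply/measurable_EFinP; apply: measurable_funM => //.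
    exact: measurable_funM.
  - move=> r x _; rewrite EFinM mule_ge0 ?lee_fin//.
    by rewrite -lee_fin EFinM nnfun_muleindic_ge0.
  apply: eq_bigr => r _.
  have mA : measurable (g n @^-1` [set r]) by exact: measurable_sfunP.
  have [r0|r0] := ltrP r 0.
    rewrite preimage_nnfun0// measure0 mule0 integral0_eq// => x _.
    by rewrite indic0 mulr0 mul0r.
  rewrite nuE// integral_mkcond -ge0_integralZl//; last 2 first.
  - apply/(measurable_restrictT _ mA); apply: measurable_funTS.
    exact/measurable_EFinP.
  - by move=> x _; rewrite patchE; case: ifP; rewrite ?lee_fin.
  apply: eq_integral => x _; rewrite patchE indicE.
  by case: ifP => _; rewrite -?EFinM ?mulr1 ?mulr0 ?mul0r ?mule0.
transitivity (limn (fun n => \int[mu]_x ((g n x)%:E * (h x)%:E))%E).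
  by apply: congr_lim; apply/funext => n /=; exact: simple.
rewrite -monotone_convergence//.
- apply: eq_integral => x _; apply/cvg_lim => //.
  exact: cvgeZr.
- by move=> n; apply/measurable_EFinP; exact: measurable_funM.
- by move=> n x _; rewrite mule_ge0// lee_fin.
- by move=> x _ p q pq; rewrite lee_wpmul2r// lee_fin//; exact: nd_g.
Qed.

(** Shape 0 is the Dirac mass at 0: it is the neutral element that makes the
    Erlang laws of a fixed rate a convolution semigroup. *)
Definition erlang_law (R : realType) (b : {posnum R}) (n : nat)
    (A : set (measurableTypeR R)) : \bar R :=
  if n is 0 then @dirac _ (measurableTypeR R) 0 R A
  else (\int[lebesgue_measure]_(x in A) (erlang_pdf n b%:num x)%:E)%E.

Section erlang_law.
Variables (R : realType) (b : {posnum R}) (n : nat).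

Let erlang_law0 : erlang_law b n set0 = 0%E.
Proof. by rewrite /erlang_law; case: n => [|k]; rewrite ?measure0 ?integral_set0. Qed.

Let erlang_law_ge0 A : (0 <= erlang_law b n A)%E.
Proof.
rewrite /erlang_law; case: n => [//|k]; apply: integral_ge0 => x _.
by rewrite lee_fin erlang_pdf_ge0.
Qed.

Let erlang_law_sigma_additive : semi_sigma_additive (erlang_law b n).
Proof.
rewrite /erlang_law; case: n => [|k].
  exact: (@measure_semi_sigma_additive _ _ _ (@dirac _ (measurableTypeR R) 0 R)).
move=> /= F mF tF mUF; apply: cvg_toP.
  apply: ereal_nondecreasing_is_cvgn => p q pq.
  apply: lee_sum_nneg_natr => // j _ _; apply: integral_ge0 => /= x _.
  by rewrite lee_fin erlang_pdf_ge0.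
rewrite ge0_integral_bigcup//=.
- by apply/measurable_funTS/measurable_EFinP; exact: measurable_erlang_pdf.
- by move=> x _; rewrite lee_fin erlang_pdf_ge0.
Qed.

HB.instance Definition _ := isMeasure.Build _ _ _
  (erlang_law b n) erlang_law0 erlang_law_ge0 erlang_law_sigma_additive.

Let erlang_law_setT : erlang_law b n setT = 1%E.
Proof.
rewrite /erlang_law; case: n => [|k]; first by rewrite diracT.
exact: integral_erlang_pdf.
Qed.

HB.instance Definition _ :=
  @Measure_isProbability.Build _ _ R (erlang_law b n) erlang_law_setT.

End erlang_law.

Lemma ge0_integral_erlang_law (R : realType) (b : {posnum R}) (n : nat)
    (f : R -> \bar R) :
  measurable_fun setT f -> (forall x, 0 <= f x)%E ->
  (\int[erlang_law b n.+1]_x f x =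
   \int[lebesgue_measure]_x (f x * (erlang_pdf n.+1 b%:num x)%:E))%E.
Proof.
move=> mf f0; apply: (@ge0_integral_density _ _ R lebesgue_measure (erlang_law b n.+1)) => //.
  exact: measurable_erlang_pdf.
by move=> x; exact: erlang_pdf_ge0.
Qed.

Lemma integral_erlang_law0 (R : realType) (b : {posnum R})
    (f : R -> \bar R) :
  measurable_fun setT f -> (\int[erlang_law b 0]_x f x = f 0%R)%E.
Proof.
move=> mf; have := @integral_dirac _ (measurableTypeR R) (0 : R) R setT measurableT f mf.
by rewrite diracT mul1e.
Qed.

(** Lebesgue measure is translation invariant, as seen on half-open intervals.
    *)
Lemma lebesgue_integral_shift (R : realType) (a : R) (f : R -> \bar R) :
  measurable_fun setT f -> (forall x, 0 <= f x)%E ->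
  (\int[lebesgue_measure]_x f (a + x)%R = \int[lebesgue_measure]_x f x)%E.
Proof.
move=> mf f0.
pose shift (x : measurableTypeR R) : measurableTypeR R := a + x.
have mshift : measurable_fun setT shift by exact: measurable_funD.
have shiftE A : measurable A -> lebesgue_measure A = pushforward lebesgue_measure shift A.
  move=> mA; apply/lebesgue_measure_unique => //= _ [[x y]] _ <-.
  rewrite /pushforward.
  rewrite (_ : _ @^-1` _ = `]x - a, y - a]%classic); last first.
    by apply/seteqP; split => z /=; rewrite !in_itv/= ltrBlDl lerBrDl.
  rewrite !lebesgue_measure_itv/= !lte_fin ltrD2r.
  by case: ifPn => // _; rewrite -!EFinD; congr EFin; ring.
rewrite [RHS](eq_measure_integral (pushforward lebesgue_measure shift)); last first.
  by move=> A mA _; exact: shiftE.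
by rewrite ge0_integral_pushforward.
Qed.

(** The Beta integral on the segment from 0 to [s], by rescaling to the unit
    interval. *)
Lemma integral_power_beta (R : realType) (s : R) (i j : nat) : 0 < s ->
  (\int[lebesgue_measure]_(x in `[0%R, s]) (x ^+ i * (s - x) ^+ j)%:E =
   (s ^+ (i + j).+1 * (i`! * j`!)%:R / (i + j).+1`!%:R)%:E)%E.
Proof.
move=> s0.
have derM : (fun t : R => t * s)^`()%classic = cst s.
  by apply/funext => z; rewrite derive1Mr// derive1_id mul1r.
have cG : continuous (fun x : R => x ^+ i * (s - x) ^+ j).
  move=> x; apply: cvgM; first exact: exprn_continuous.
  apply: (@continuous_comp _ _ _ (fun x => s - x) (fun x => x ^+ j)).
    by apply: cvgB; [exact: cvg_cst|exact: cvg_id].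
  exact: exprn_continuous.
have := @integration_by_substitution_increasing R (fun t => t * s)
  (fun x : R => x ^+ i * (s - x) ^+ j) _ _ ler01.
rewrite mul0r mul1r => ->//=; last 6 first.
  - move=> x y; rewrite !in_itv/= => /andP[x0 x1] /andP[y0 y1] xy.
    by rewrite ltr_pM2r.
  - by rewrite derM => z _; exact: cvg_cst.
  - by rewrite derM; exact: is_cvg_cst.
  - by rewrite derM; exact: is_cvg_cst.
  - split => //.
    + apply: cvg_at_right_filter.
      by apply: cvgM => //; exact: cvg_cst.
    + apply: cvg_at_left_filter.
      by apply: cvgM => //; exact: cvg_cst.
  - exact: continuous_subspaceT.
rewrite derM.
transitivity (\int[lebesgue_measure]_(t in `[0%R, 1%R])
    ((s ^+ (i + j).+1)%:E * (XMonemX i j t)%:E))%E.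
  apply: eq_integral => t _; rewrite -EFinM; congr EFin.
  rewrite (_ : XMonemX i j t = t ^+ i * (1 - t) ^+ j)// !fctE/=.
  rewrite (_ : s - t * s = s * (1 - t)); last by ring.
  by rewrite !exprMn exprS exprD; ring.
rewrite ge0_integralZl//=.
- rewrite (_ : \int[_]_(t in _) _ = (beta_fun i.+1 j.+1)%:E)%E.
    by rewrite beta_fun_fact -EFinM mulrA.
  rewrite EFin_beta_fun integral_mkcond; apply: eq_integral => t _.
  by rewrite !patchE; case: ifP.
- by apply/measurable_EFinP; exact: measurable_XMonemX.
- by move=> t t01; rewrite lee_fin; exact: XMonemX_ge0.
- by rewrite lee_fin exprn_ge0// ltW.
Qed.

(** The exponential factors combine to [expR (- (b * s))], which leaves a Beta
    integral. *)
Lemma erlang_pdf_conv (R : realType) (b s : R) (i j : nat) : 0 <= b ->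
  (\int[lebesgue_measure]_x (erlang_pdf i.+1 b x * erlang_pdf j.+1 b (s - x))%:E =
   (erlang_pdf (i + j).+2 b s)%:E)%E.
Proof.
move=> b0.
transitivity (\int[lebesgue_measure]_(x in `[0%R, s])
    (erlang_pdf i.+1 b x * erlang_pdf j.+1 b (s - x))%:E)%E.
  rewrite [RHS]integral_mkcond; apply: eq_integral => x _; rewrite patchE.
  case: ifPn => //; rewrite notin_setE/= in_itv/= => /negP.
  rewrite negb_and -!ltNge => /orP[x0|x0].
    by rewrite erlang_pdf_lt0// mul0r.
  by rewrite [X in _ * X]erlang_pdf_lt0 ?mulr0// subr_lt0.
have [s0|s0|->] := ltrgtP s 0.
- by rewrite set_itv_ge ?bnd_simp -?ltNge// integral_set0 erlang_pdf_lt0.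
- transitivity (\int[lebesgue_measure]_(x in `[0%R, s])
      ((b ^+ (i + j).+2 * expR (- (b * s)) / (i`! * j`!)%:R)%:E *
       (x ^+ i * (s - x) ^+ j)%:E))%E.
    apply: eq_integral.
    move=> x; rewrite inE/= in_itv/= => /andP[x0 xs].
    rewrite -EFinM; congr EFin.
    rewrite !erlang_pdfE ?subr_ge0// /poisson_weight.
    rewrite (_ : - (b * s) = - (b * x) + - (b * (s - x))); last by ring.
    rewrite expRD !exprMn natrM !exprS exprD.
    have hi : (i`!%:R : R) != 0 by rewrite pnatr_eq0 -lt0n fact_gt0.
    have hj : (j`!%:R : R) != 0 by rewrite pnatr_eq0 -lt0n fact_gt0.
    by field; rewrite hi hj.
  rewrite ge0_integralZl//=.
  + rewrite integral_power_beta// -EFinM; congr EFin.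
    rewrite erlang_pdfE ?ltW// /poisson_weight exprMn natrM.
    have hi : (i`!%:R : R) != 0 by rewrite pnatr_eq0 -lt0n fact_gt0.
    have hj : (j`!%:R : R) != 0 by rewrite pnatr_eq0 -lt0n fact_gt0.
    have hk : ((i + j).+1`!%:R : R) != 0 by rewrite pnatr_eq0 -lt0n fact_gt0.
    rewrite (exprS b (i + j).+1).
    by field; rewrite hi hj hk.
  + apply/measurable_EFinP; apply: measurable_funM.
      by apply: measurable_funTS; exact: exprn_measurable.
    by apply: measurable_funX; exact: measurable_funB.
  + move=> x; rewrite in_itv/= => /andP[x0 xs].
    by rewrite lee_fin mulr_ge0 ?exprn_ge0 ?subr_ge0.
  + by rewrite lee_fin divr_ge0// mulr_ge0 ?expR_ge0// exprn_ge0.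
- rewrite set_itv1 integral_set1 erlang_pdfE// mulr0 /poisson_weight expr0n/=.
  by rewrite mulr0 mul0r mulr0.
Qed.

Lemma measurable_addr (R : realType) (B : set (measurableTypeR R)) :
  measurable B ->
  measurable [set z : measurableTypeR R * measurableTypeR R | B (z.1 + z.2)].
Proof.
move=> mB; rewrite -[X in measurable X]setTI.
have : measurable_fun setT (fun z : measurableTypeR R * measurableTypeR R => z.1 + z.2).
  by apply: measurable_funD; [exact: measurable_fst|exact: measurable_snd].
exact.
Qed.

(** The sum of independent Erlang variables of the same rate is Erlang: for
    positive shapes, Tonelli and a translation turn the law of the sum into the
    convolution of the densities. *)
Lemma erlang_law_conv (R : realType) (b : {posnum R}) (i j : nat)
    (B : set (measurableTypeR R)) : measurable B ->
  ((erlang_law b i \x erlang_law b j) [set z | B (z.1 + z.2)%R] =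
   erlang_law b (i + j) B)%E.
Proof.
move=> mB.
pose psi x := erlang_law b j [set y | B (x + y)].
have mpsi : measurable_fun setT psi.
  have := @measurable_fun_xsection _ _ (measurableTypeR R) (measurableTypeR R) R
     (erlang_law b j) _ (measurable_addr mB).
  apply: eq_measurable_fun => x _ /=; congr (erlang_law b j _).
  by apply/seteqP; split => y; rewrite /xsection /= inE.
have psi0 x : (0 <= psi x)%E by exact: measure_ge0.
transitivity (\int[erlang_law b i]_x psi x)%E.
  rewrite /product_measure1; apply: eq_integral => x _ /=; congr (erlang_law b j _).
  by apply/seteqP; split => y; rewrite /xsection /= inE.
case: i => [|i].
  rewrite integral_erlang_law0// /psi; congr (erlang_law b j _).
  by apply/seteqP; split => y /=; rewrite add0r.
case: j @psi mpsi psi0 => [|j] psi mpsi psi0.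
  transitivity (\int[erlang_law b i.+1]_x (\1_B x)%:E)%E.
    apply: eq_integral => x _; rewrite /psi /erlang_law diracE indicE.
    by congr ((_ : bool)%:R%:E); apply/idP/idP; rewrite !inE/= addr0.
  by rewrite integral_indic// setIT addn0.
rewrite ge0_integral_erlang_law//.
transitivity (\int[lebesgue_measure]_x \int[lebesgue_measure]_y
    ((erlang_pdf i.+1 b%:num x)%:E * ((\1_B y)%:E * (erlang_pdf j.+1 b%:num (y - x))%:E)))%E.
  apply: eq_integral => x _.
  rewrite ge0_integralZl//; last 3 first.
  - apply: emeasurable_funM.
      apply/measurable_EFinP; exact: measurable_indic.
    apply/measurable_EFinP; apply: measurableT_comp; first exact: measurable_erlang_pdf.
    exact: measurable_funB.
  - by move=> y _; rewrite mule_ge0// lee_fin erlang_pdf_ge0.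
  - by rewrite lee_fin erlang_pdf_ge0.
  rewrite muleC; congr (_ * _)%E.
  rewrite -(@lebesgue_integral_shift _ x); last 2 first.
  - apply: emeasurable_funM.
      apply/measurable_EFinP; exact: measurable_indic.
    apply/measurable_EFinP; apply: measurableT_comp; first exact: measurable_erlang_pdf.
    exact: measurable_funB.
  - by move=> y; rewrite mule_ge0// lee_fin erlang_pdf_ge0.
  rewrite /psi /erlang_law integral_mkcond; apply: eq_integral => y _.
  rewrite patchE indicE (_ : x + y - x = y); last by rewrite addrC addKr.
  rewrite (_ : (y \in [set y | B (x + y)]) = (x + y \in B)).
    by case: ifP; rewrite ?mul1e ?mul0e.
  by apply/idP/idP; rewrite !inE.
pose f (z : measurableTypeR R * measurableTypeR R) :=
  ((erlang_pdf i.+1 b%:num z.1)%:E *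
    ((\1_B z.2)%:E * (erlang_pdf j.+1 b%:num (z.2 - z.1))%:E))%E.
have mf : measurable_fun setT f.
  apply: emeasurable_funM.
    apply/measurable_EFinP; apply: measurableT_comp; last exact: measurable_fst.
    exact: measurable_erlang_pdf.
  apply: emeasurable_funM.
    apply/measurable_EFinP; apply: measurableT_comp; last exact: measurable_snd.
    exact: measurable_indic.
  apply/measurable_EFinP; apply: measurableT_comp; first exact: measurable_erlang_pdf.
  by apply: measurable_funB; [exact: measurable_snd|exact: measurable_fst].
have f0 z : (0 <= f z)%E.
  by rewrite !mule_ge0// lee_fin erlang_pdf_ge0.
have := @fubini_tonelli _ _ _ _ R lebesgue_measure lebesgue_measure f mf f0.
rewrite /f/= => ->.
rewrite /erlang_law addnS addSn [RHS]integral_mkcond; apply: eq_integral => y _.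
rewrite patchE indicE; case: ifPn => [yB|yB]; last first.
  by rewrite integral0_eq// => x _; rewrite mul0e mule0.
rewrite -erlang_pdf_conv//; apply: eq_integral => x _.
by rewrite mul1e.
Qed.

(** * Minimum and maximum of two mixed Erlang variables *)

Lemma nneseries_geq (R : realType) (f : nat -> \bar R) (n : nat) :
  (\sum_(n <= i <oo) f i = \sum_(0 <= i <oo) (if (n <= i)%N then f i else 0))%E.
Proof. by rewrite eseries_cond eseries_mkcond. Qed.

Lemma erlang_law_lt0 (R : realType) (b : {posnum R}) (n : nat) (x : R) : x < 0 ->
  erlang_law b n `]-oo, x] = 0%E.
Proof.
move=> x0; case: n => [|n]; rewrite /erlang_law.
  by rewrite diracE memNset//= in_itv/= leNgt x0.
apply: integral0_eq => y; rewrite /= in_itv/= => yx.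
by rewrite erlang_pdf_lt0// (le_lt_trans yx).
Qed.

(** The Erlang-Poisson duality: the [n]-th arrival of a Poisson process of rate
    [b] occurs before [x] when at least [n] points lie between 0 and [x]. *)
Lemma erlang_law_poisson (R : realType) (b : {posnum R}) (n : nat) (x : R) : 0 <= x ->
  erlang_law b n `]-oo, x] = (\sum_(n <= i <oo) (poisson_weight (b%:num * x) i)%:E)%E.
Proof.
move=> x0.
have bx0 : 0 <= b%:num * x by rewrite mulr_ge0.
have p0 i : (0 <= (poisson_weight (b%:num * x) i)%:E)%E.
  by rewrite lee_fin poisson_weight_ge0.
have := sum_poisson_weight bx0.
rewrite (@nneseries_split _ _ 0 n); last by move=> k _; exact: p0.
rewrite add0n sumEFin => /(congr1 (fun z =>
  z - (\sum_(0 <= i < n) poisson_weight (b%:num * x) i)%:E))%E.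
rewrite addeAC subee// add0e => ->.
case: n => [|n].
  by rewrite big_geq// sube0 /erlang_law diracE mem_set//= in_itv.
by rewrite -EFinB /erlang_law integral_erlang_pdf_itv.
Qed.

Lemma erlang_cdfE (R : realType) (b : {posnum R}) (n : nat) (x : R) : (1 <= n)%N ->
  (erlang_cdf n b%:num x)%:E = erlang_law b n `]-oo, x].
Proof.
case: n => // n _; rewrite /erlang_cdf /Rintegral -[integral _ _ _]/(erlang_law b n.+1 `]-oo, x]).
by rewrite fineK// fin_num_measure.
Qed.

Lemma erlang_ccdfE (R : realType) (b : {posnum R}) (n : nat) (x : R) : (1 <= n)%N ->
  (erlang_ccdf n b%:num x)%:E = erlang_law b n `]x, +oo[.
Proof.
move=> n1; rewrite /erlang_ccdf EFinB erlang_cdfE// -setCitvl probability_setC//.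
Qed.

(** By the Erlang-Poisson duality and an exchange of sums, the Poisson
    coefficients of a mixed Erlang cdf are the partial sums of its weights. *)
Lemma sum_erlang_law_poisson (R : realType) (b : {posnum R}) (u : nat -> R) (x : R) :
  (forall n, (1 <= n)%N -> 0 <= u n) -> 0 <= x ->
  (\sum_(1 <= n <oo) (u n)%:E * erlang_law b n `]-oo, x] =
   \sum_(0 <= i <oo) (cumul_weight u i * poisson_weight (b%:num * x) i)%:E)%E.
Proof.
move=> u0 x0; set t := b%:num * x.
have t0 : 0 <= t by rewrite mulr_ge0.
rewrite nneseries_geq.
transitivity (\sum_(0 <= n <oo) \sum_(0 <= i <oo)
   (if (1 <= n)%N && (n <= i)%N then (u n * poisson_weight t i)%:E else 0))%E.
  apply: eq_eseriesr => n _; case: ifPn => n1; last by rewrite eseries0.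
  rewrite erlang_law_poisson// nneseries_geq -nneseriesZl; last first.
    by move=> i _; case: ifP => // _; rewrite lee_fin poisson_weight_ge0.
  by apply: eq_eseriesr => i _; case: ifP => _; rewrite ?mule0.
rewrite nneseries_interchange; last first.
  move=> n i; case: ifPn => // /andP[n1 _].
  by rewrite lee_fin mulr_ge0 ?u0// poisson_weight_ge0.
apply: eq_eseriesr => i _.
transitivity (\sum_(0 <= n <oo) (if (n < i.+1)%N then
    (if (1 <= n)%N then (u n * poisson_weight t i)%:E else 0) else 0))%E.
  by apply: eq_eseriesr => n _; rewrite ltnS; case: leqP => ?; case: leqP.
rewrite nneseries_ltn; last first.
  by move=> n; case: ifP => // n1; rewrite lee_fin mulr_ge0 ?u0// poisson_weight_ge0.
rewrite big_nat_recl//= add0e /cumul_weight big_add1 sumEFin; congr EFin.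
by rewrite mulr_suml.
Qed.

(** A Cauchy product, whose antidiagonals are collected by
    [poisson_weight_mul]. *)
Lemma poisson_series_mul (R : realType) (t r r' : R) (u v : nat -> R) :
  0 <= t -> (forall n, 0 <= u n) -> (forall n, 0 <= v n) ->
  (\sum_(0 <= i <oo) (u i * poisson_weight t i)%:E = r%:E)%E ->
  (\sum_(0 <= i <oo) (v i * poisson_weight t i)%:E = r'%:E)%E ->
  ((r * r')%:E = \sum_(0 <= n <oo) (binomial_mean u v n * poisson_weight (2 * t) n)%:E)%E.
Proof.
move=> t0 u0 v0 ur vr.
have up0 i : 0 <= u i * poisson_weight t i by rewrite mulr_ge0 ?poisson_weight_ge0.
have vp0 i : 0 <= v i * poisson_weight t i by rewrite mulr_ge0 ?poisson_weight_ge0.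
rewrite mulrC EFinM -ur -nneseriesZl; last by move=> i _; rewrite lee_fin.
transitivity (\sum_(0 <= i <oo) \sum_(0 <= j <oo)
   ((u i * poisson_weight t i) * (v j * poisson_weight t j))%:E)%E.
  apply: eq_eseriesr => i _; rewrite muleC -vr -nneseriesZl//.
  by move=> j _; rewrite lee_fin.
rewrite nneseries_diagonal; last by move=> i j; rewrite lee_fin mulr_ge0.
apply: eq_eseriesr => n _; rewrite sumEFin; congr EFin.
rewrite /binomial_mean mulrAC mulr_sumr !big_nat; apply: eq_bigr => i /andP[_ iN].
by rewrite mulrACA poisson_weight_mul//; ring.
Qed.

Lemma cumul_weight_ge0 (R : realType) (q : nat -> R) (n : nat) :
  (forall j, (1 <= j)%N -> 0 <= q j) -> 0 <= cumul_weight q n.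
Proof.
by move=> q0; rewrite /cumul_weight big_nat sumr_ge0// => i /andP[i1 _]; exact: q0.
Qed.

Lemma cumul_weight_le1 (R : realType) (q : nat -> R) (n : nat) :
  probability_weights q -> cumul_weight q n <= 1.
Proof.
move=> [q0 q1]; rewrite -lee_fin -q1 -sumEFin.
by apply: nneseries_lim_ge => i i1 _; rewrite lee_fin q0.
Qed.

Lemma order_weight_ge0 (R : realType) (q : nat -> R) (o : bool) (n : nat) :
  probability_weights q -> 0 <= order_weight q o n.
Proof.
move=> hq; have [q0 _] := hq.
rewrite /order_weight /min_weight /max_weight.
case: o; rewrite mulr_ge0 ?invr_ge0 ?exprn_ge0// sumr_ge0// => i _.
  by rewrite !mulr_ge0 ?q0 ?cumul_weight_ge0.
by rewrite !mulr_ge0 ?q0 ?subr_ge0 ?cumul_weight_le1.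
Qed.

(** The reason for [min_weight] and [max_weight]. Expanded in Poisson weights
    of parameter [2 * b * x], the square of the mixed Erlang cdf [r] has the
    partial sums of [max_weight] as coefficients; the minimum has cdf [2 * r - r ^+
    2], and is handled by subtracting the maximum from [2 * r], which keeps all
    series nonnegative. *)
Lemma order_weight_cdf (R : realType) (b b2 : {posnum R}) (q : nat -> R)
    (o : bool) (x r : R) :
  b2%:num = 2 * b%:num -> probability_weights q -> 0 <= x ->
  (r%:E = \sum_(1 <= n <oo) (q n * erlang_cdf n b%:num x)%:E)%E ->
  (\sum_(1 <= n <oo) (order_weight q o n)%:E * erlang_law b2 n `]-oo, x] =
   (order_unif_cdf o r)%:E)%E.
Proof.
move=> bb hq x0 rE; have [q0 q1] := hq.
have Q0 n : 0 <= cumul_weight q n by exact: cumul_weight_ge0.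
set t := b%:num * x.
have t0 : 0 <= t by rewrite mulr_ge0.
have tE : b2%:num * x = 2 * t by rewrite bb mulrA.
have rQ : (\sum_(0 <= i <oo) (cumul_weight q i * poisson_weight t i)%:E = r%:E)%E.
  rewrite -sum_erlang_law_poisson// rE [LHS]nneseries_geq [RHS]nneseries_geq.
  by apply: eq_eseriesr => n _; case: ifP => // n1; rewrite EFinM erlang_cdfE.
have one : (\sum_(0 <= i <oo) ((fun=> 1) i * poisson_weight t i)%:E = 1%:E)%E.
  by under eq_eseriesr do rewrite mul1r; exact: sum_poisson_weight.
have maxE : (\sum_(1 <= n <oo) (max_weight q n)%:E * erlang_law b2 n `]-oo, x] =
    (r * r)%:E)%E.
  rewrite sum_erlang_law_poisson//; last first.
    by move=> n _; exact: (order_weight_ge0 true).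
  rewrite tE (poisson_series_mul t0 Q0 Q0 rQ rQ); apply: eq_eseriesr => n _.
  by rewrite cumul_max_weight.
case: o => /=; first by rewrite maxE expr2.
have min0 n : 0 <= min_weight q n by exact: (order_weight_ge0 false).
have max0 n : 0 <= max_weight q n by exact: (order_weight_ge0 true).
suff : (\sum_(1 <= n <oo) (min_weight q n)%:E * erlang_law b2 n `]-oo, x] +
    (r * r)%:E = (2 * r)%:E)%E.
  move=> /(congr1 (fun z => z - (r * r)%:E)%E); rewrite addeK// => ->.
  by rewrite -EFinB; congr EFin; ring.
rewrite -maxE !sum_erlang_law_poisson// -nneseriesD; last 2 first.
- by move=> n _ _; rewrite lee_fin mulr_ge0 ?cumul_weight_ge0 ?poisson_weight_ge0 ?tE ?mulr_ge0.
- by move=> n _ _; rewrite lee_fin mulr_ge0 ?cumul_weight_ge0 ?poisson_weight_ge0 ?tE ?mulr_ge0.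
rewrite -[r]mulr1 EFinM (poisson_series_mul t0 Q0 (fun=> ler01) rQ one) tE -nneseriesZl.
  by apply: eq_eseriesr => n _; rewrite -EFinD -mulrDl cumul_minmax_weight -mulrA EFinM.
move=> n _; rewrite lee_fin mulr_ge0 ?poisson_weight_ge0 ?mulr_ge0//.
by rewrite sumr_ge0// => i _; rewrite !mulr_ge0.
Qed.

(** * Size-biased Erlang laws *)

(** Multiplication by [x] raises the shape of an Erlang density by one; this
    produces the factor [ell / (2 * beta)] and the shape [l + 1] of both
    allocations. *)
Lemma mul_erlang_pdf (R : realType) (b x : R) (i : nat) : 0 < b ->
  x * erlang_pdf i.+1 b x = i.+1%:R / b * erlang_pdf i.+2 b x.
Proof.
move=> b0; have [x0|x0] := lerP 0 x; last by rewrite !erlang_pdf_lt0// !mulr0.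
rewrite !erlang_pdfE// /poisson_weight factS natrM exprS.
have hi : (i`!%:R : R) != 0 by rewrite pnatr_eq0 -lt0n fact_gt0.
have hi1 : (1 + i%:R : R) != 0 by rewrite nat1r pnatr_eq0.
by field; rewrite hi hi1 gt_eqF.
Qed.

(** The maximum with 0 keeps the integrand nonnegative on the whole line
    without changing it on the support. *)
Lemma erlang_law_moment (R : realType) (b : {posnum R}) (i : nat) (f : R -> \bar R) :
  measurable_fun setT f -> (forall x, 0 <= f x)%E ->
  (\int[erlang_law b i]_x ((Num.max x 0)%:E * f x) =
   (i%:R / b%:num)%:E * \int[erlang_law b i.+1]_x f x)%E.
Proof.
move=> mf f0.
have mm : measurable_fun setT (fun x : R => ((Num.max x 0)%:E * f x)%E).
  by apply: emeasurable_funM => //; apply/measurable_EFinP; exact: measurable_maxr.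
case: i => [|i].
  by rewrite integral_erlang_law0// maxxx !mul0r !mul0e.
rewrite !ge0_integral_erlang_law//; last first.
  by move=> x; rewrite mule_ge0// lee_fin le_max lexx orbT.
rewrite -ge0_integralZl//; last 2 first.
- apply: emeasurable_funM => //; apply/measurable_EFinP; exact: measurable_erlang_pdf.
- by move=> x _; rewrite mule_ge0// lee_fin erlang_pdf_ge0.
apply: eq_integral => x _.
rewrite muleAC [RHS]muleCA [LHS]muleC -!EFinM; congr (_ * _%:E)%E.
rewrite -mul_erlang_pdf//; have [x0|//] := lerP x 0.
move: x0; rewrite le_eqVlt => /predU1P[->|x0]; first by rewrite !mul0r.
by rewrite erlang_pdf_lt0// !mulr0.
Qed.

(** * Uniqueness of measures and mixtures *)

(** Half-open intervals are differences of half-lines, and they form a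
    generating family closed under intersection. *)
Lemma halfline_measure_unique (R : realType)
    (m1 m2 : {measure set (measurableTypeR R) -> \bar R}) :
  (m1 setT < +oo)%E ->
  (forall x : R, m1 `]-oo, x]%classic = m2 `]-oo, x]%classic) ->
  forall A, measurable A -> m1 A = m2 A.
Proof.
move=> m1T m12 A mA.
have fin B : measurable B -> (m1 B < +oo)%E.
  by move=> mB; apply: le_lt_trans m1T; apply: le_measure; rewrite ?inE.
apply: (@measure_unique _ R (measurableTypeR R) (@ocitv R)
  (fun n : nat => `](- n%:R : R), n%:R]%classic)) => //.
- exact: ocitvI.
- by move=> n; exact: is_ocitv.
- apply/seteqP; split => // x _.
  exists (Num.truncn `|x|).+1 => //=; rewrite in_itv/=.
  have := truncnS_gt `|x|; rewrite ltr_norml => /andP[-> /ltW ->]//.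
- move=> _ [[x y] _ <-]/=.
  have [xy|yx] := lerP x y; last by rewrite set_itv_ge ?measure0// bnd_simp -leNgt ltW.
  have -> : `]x, y]%classic = `]-oo, y] `\` `]-oo, x].
    by rewrite -[RHS]setCK setCD setCitvl setUC -[LHS]setCK setCitv.
  rewrite !measureD//=.
  + rewrite setIidr; last by apply: subset_itvl; rewrite bnd_simp.
    by rewrite !m12.
  + by rewrite -m12; exact: fin.
  + exact: fin.
- by move=> n; exact: fin.
Qed.

Lemma rectangle_measure_unique (d1 d2 : measure_display) (T1 : measurableType d1)
    (T2 : measurableType d2) (R : realType)
    (m1 m2 : {measure set (T1 * T2) -> \bar R}) :
  (m1 setT < +oo)%E ->
  (forall A B, measurable A -> measurable B -> m1 (A `*` B) = m2 (A `*` B)) ->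
  forall D, measurable D -> m1 D = m2 D.
Proof.
move=> m1T m12 D mD.
pose G : set (set (T1 * T2)) :=
  [set C | exists A, measurable A /\ exists B, measurable B /\ C = A `*` B].
apply: (measure_unique G (fun=> setT)) => //.
- rewrite measurable_prod_measurableType//; congr (<<s _ >>).
  apply/seteqP; split => [_ [A mA [B mB <-]]|_ [A [mA [B [mB ->]]]]].
    by exists A; split => //; exists B.
  by exists A => //; exists B.
- move=> _ _ [A [mA [B [mB ->]]]] [A' [mA' [B' [mB' ->]]]].
  rewrite -setXI; exists (A `&` A'); split; first exact: measurableI.
  by exists (B `&` B'); split => //; exact: measurableI.
- by move=> _; exists setT; split => //; exists setT; split => //; rewrite setXTT.
- by rewrite bigcup_const//; exists 0%N.
- by move=> _ [A [mA [B [mB ->]]]]; exact: m12.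
Qed.

Definition mixture (d : measure_display) (T : measurableType d) (R : realType)
    (p : nat -> {nonneg R}) (mu : nat -> {measure set T -> \bar R}) :
    set T -> \bar R :=
  mseries (fun n => mscale (p n) (mu n)) 0.

HB.instance Definition _ (d : measure_display) (T : measurableType d)
    (R : realType) (p : nat -> {nonneg R}) (mu : nat -> {measure set T -> \bar R}) :=
  Measure.on (mixture p mu).

Lemma mixtureE (d : measure_display) (T : measurableType d) (R : realType)
    (p : nat -> {nonneg R}) (mu : nat -> {measure set T -> \bar R}) (A : set T) :
  mixture p mu A = (\sum_(0 <= n <oo) (p n)%:num%:E * mu n A)%E.
Proof. by []. Qed.

Lemma ge0_integral_mixture (d : measure_display) (T : measurableType d) (R : realType)
    (p : nat -> {nonneg R}) (mu : nat -> {measure set T -> \bar R}) (f : T -> \bar R) :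
  measurable_fun setT f -> (forall x, 0 <= f x)%E ->
  (\int[mixture p mu]_x f x =
   \sum_(0 <= n <oo) (p n)%:num%:E * \int[mu n]_x f x)%E.
Proof.
move=> mf f0; rewrite ge0_integral_measure_series//.
by apply: eq_eseriesr => n _; rewrite ge0_integral_mscale.
Qed.

(** Defined directly by its values, since the index type is finite and need not
    be ordered. *)
Definition finite_mixture (d : measure_display) (T : measurableType d) (R : realType)
    (F : finType) (c : F -> {nonneg R}) (mu : F -> {measure set T -> \bar R}) :
    set T -> \bar R :=
  fun A => (\sum_i (c i)%:num%:E * mu i A)%E.

Section finite_mixture.
Variables (d : measure_display) (T : measurableType d) (R : realType).
Variables (F : finType) (c : F -> {nonneg R}) (mu : F -> {measure set T -> \bar R}).

Let finite_mixture0 : finite_mixture c mu set0 = 0%E.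
Proof. by rewrite /finite_mixture big1// => i _; rewrite measure0 mule0. Qed.

Let finite_mixture_ge0 A : (0 <= finite_mixture c mu A)%E.
Proof. by apply: sume_ge0 => i _; rewrite mule_ge0. Qed.

Let finite_mixture_sigma_additive : semi_sigma_additive (finite_mixture c mu).
Proof.
move=> B mB tB mUB; apply: cvg_toP.
  apply: ereal_nondecreasing_is_cvgn => p q pq.
  by apply: lee_sum_nneg_natr => // k _ _; exact: finite_mixture_ge0.
rewrite /finite_mixture nneseries_sum; last by move=> i j _; rewrite mule_ge0.
apply: eq_bigr => i _.
rewrite nneseriesZl//; congr (_ * _)%E.
by apply/esym/measure_semi_bigcup.
Qed.

HB.instance Definition _ := isMeasure.Build _ _ _ (finite_mixture c mu)
  finite_mixture0 finite_mixture_ge0 finite_mixture_sigma_additive.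

End finite_mixture.

Lemma ge0_integral_finite_mixture (d : measure_display) (T : measurableType d) (R : realType)
    (F : finType) (c : F -> {nonneg R}) (mu : F -> {measure set T -> \bar R}) (f : T -> \bar R) :
  measurable_fun setT f -> (forall x, 0 <= f x)%E ->
  (\int[finite_mixture c mu]_x f x = \sum_i (c i)%:num%:E * \int[mu i]_x f x)%E.
Proof.
move=> mf f0.
pose m_ n : {measure set T -> \bar R} := if insub n is Some k
  then mscale (c (enum_val (k : 'I_#|F|))) (mu (enum_val k)) else mzero.
have m_E (k : 'I_#|F|) : m_ k = mscale (c (enum_val k)) (mu (enum_val k)).
  by rewrite /m_ valK.
have sumE (g : F -> \bar R) : (\sum_i g i = \sum_(k < #|F|) g (enum_val k))%E.
  by rewrite -(big_enum_val (A := F)).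
rewrite (eq_measure_integral (msum m_ #|F|)); last first.
  move=> A mA _; rewrite /= /finite_mixture /msum sumE.
  by apply: eq_bigr => k _; rewrite m_E.
rewrite ge0_integral_measure_sum// sumE; apply: eq_bigr => k _.
by rewrite m_E ge0_integral_mscale.
Qed.

(** * Convolution of mixtures and laws of pairs *)

Definition pair_mixture (R : realType) (p r : nat -> {nonneg R})
    (E : nat -> probability (measurableTypeR R) R) :=
  mixture p (fun n => mixture r (fun l => (E n \x E l)%E)).

HB.instance Definition _ (R : realType) (p r : nat -> {nonneg R})
    (E : nat -> probability (measurableTypeR R) R) :=
  Measure.on (pair_mixture p r E).

Definition weight_sum1 (R : realType) (p : nat -> {nonneg R}) : Prop :=
  (\sum_(0 <= n <oo) (p n)%:num%:E = 1)%E.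

Lemma mixture_fin_num (R : realType) (p : nat -> {nonneg R})
    (E : nat -> probability (measurableTypeR R) R) (A : set (measurableTypeR R)) :
  weight_sum1 p -> measurable A -> mixture p E A \is a fin_num.
Proof.
move=> p1 mA; rewrite ge0_fin_numE// mixtureE (@le_lt_trans _ _ 1%E) ?ltry// -p1.
apply: lee_nneseries => [n _ _|n _]; first by rewrite mule_ge0.
by rewrite -[leRHS]mule1 lee_wpmul2l// probability_le1.
Qed.

(** On a rectangle the double series factors, which says that the two
    coordinates are independent. *)
Lemma pair_mixture_setX (R : realType) (p r : nat -> {nonneg R})
    (E : nat -> probability (measurableTypeR R) R) (A B : set (measurableTypeR R)) :
  weight_sum1 p -> weight_sum1 r -> measurable A -> measurable B ->
  (pair_mixture p r E (A `*` B) = mixture p E A * mixture r E B)%E.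
Proof.
move=> p1 r1 mA mB.
have fA n : (E n : {measure set _ -> \bar R}) A = (fine (E n A))%:E.
  by rewrite fineK// fin_num_measure.
have fB : mixture r E B = (fine (mixture r E B))%:E by rewrite fineK// mixture_fin_num.
rewrite muleC fB mixtureE [in RHS]mixtureE -nneseriesZl; last first.
  by move=> n _; rewrite mule_ge0.
apply: eq_eseriesr => n _.
rewrite -fB muleCA; congr (_ * _)%E.
rewrite muleC fA /= !mixtureE -nneseriesZl; last by move=> l _; rewrite mule_ge0.
apply: eq_eseriesr => l _.
by rewrite muleCA -fA; congr (_ * _)%E; exact: product_measure1E.
Qed.

Lemma weight_conv_ge0 (R : realType) (p r : nat -> {nonneg R}) (n : nat) :
  0 <= \sum_(0 <= i < n.+1) (p i)%:num * (r (n - i)%N)%:num.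
Proof. by rewrite sumr_ge0// => i _; rewrite mulr_ge0. Qed.

(** The law of the sum of two independent integer variables with weights [p]
    and [r]. *)
Definition weight_conv (R : realType) (p r : nat -> {nonneg R}) (n : nat) :
    {nonneg R} := NngNum (weight_conv_ge0 p r n).

Lemma weight_conv_series (R : realType) (p r : nat -> {nonneg R}) (u : nat -> \bar R) :
  (forall n, 0 <= u n)%E ->
  (\sum_(0 <= i <oo) (p i)%:num%:E * \sum_(0 <= j <oo) (r j)%:num%:E * u (i + j)%N =
   \sum_(0 <= n <oo) (weight_conv p r n)%:num%:E * u n)%E.
Proof.
move=> u0.
transitivity (\sum_(0 <= i <oo) \sum_(0 <= j <oo)
    ((p i)%:num * (r j)%:num)%:E * u (i + j)%N)%E.
  apply: eq_eseriesr => i _; rewrite -nneseriesZl; last first.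
    by move=> j _; rewrite mule_ge0.
  by apply: eq_eseriesr => j _; rewrite EFinM muleA.
rewrite nneseries_diagonal; last by move=> i j; rewrite mule_ge0// lee_fin mulr_ge0.
apply: eq_eseriesr => n _ /=.
rewrite -sumEFin ge0_sume_distrl; last by move=> i _; rewrite lee_fin mulr_ge0.
by rewrite !big_nat; apply: eq_bigr => i /andP[_ ni]; rewrite subnKC.
Qed.

Lemma weight_conv_sum1 (R : realType) (p r : nat -> {nonneg R}) :
  weight_sum1 p -> weight_sum1 r -> weight_sum1 (weight_conv p r).
Proof.
move=> p1 r1; rewrite /weight_sum1.
have := @weight_conv_series R p r (fun=> 1%E) (fun=> lee01).
under eq_eseriesr => i _.
  rewrite (_ : \sum_(0 <= j <oo) _ = 1)%E; last first.
    by rewrite -[RHS]r1; apply: eq_eseriesr => j _; rewrite mule1.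
  over.
under eq_eseriesr do rewrite mule1.
rewrite p1 => ->.
by apply: eq_eseriesr => n _; rewrite mule1.
Qed.

Definition convolution_semigroup (R : realType)
    (E : nat -> probability (measurableTypeR R) R) : Prop :=
  (forall A, measurable A -> E 0%N A = (\1_A (0 : R))%:E) /\
  (forall i j (B : set (measurableTypeR R)), measurable B ->
     (E i \x E j)%E [set z : R * R | B (z.1 + z.2)] = E (i + j)%N B).

(** In a convolution semigroup, adding two independent mixed variables
    convolves the mixing weights. *)
Lemma pair_mixture_conv (R : realType) (p r : nat -> {nonneg R})
    (E : nat -> probability (measurableTypeR R) R) (B : set (measurableTypeR R)) :
  convolution_semigroup E -> measurable B ->
  pair_mixture p r E [set z | B (z.1 + z.2)] = mixture (weight_conv p r) E B.
Proof.
move=> [_ EC] mB; rewrite [RHS]mixtureE -(@weight_conv_series _ p r (fun n => E n B))//.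
rewrite /pair_mixture mixtureE; apply: eq_eseriesr => i _; congr (_ * _)%E.
rewrite /= mixtureE; apply: eq_eseriesr => j _; congr (_ * _)%E.
exact: EC.
Qed.

(** Rectangles determine a finite measure on the plane. The event [G] carries
    along the coordinates that are not being added. *)
Lemma pair_law (d : measure_display) (T : measurableType d) (R : realType)
    (P : probability T R) (F : finType) (c : F -> {nonneg R})
    (p r : F -> nat -> {nonneg R}) (E : nat -> probability (measurableTypeR R) R)
    (G : set T) (Y Z : T -> measurableTypeR R) :
  measurable G -> measurable_fun setT Y -> measurable_fun setT Z ->
  (forall i, weight_sum1 (p i)) -> (forall i, weight_sum1 (r i)) ->
  (forall A B, measurable A -> measurable B ->
    P (G `&` [set w | A (Y w) /\ B (Z w)]) =
    (\sum_i (c i)%:num%:E * (mixture (p i) E A * mixture (r i) E B))%E) ->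
  forall D, measurable D ->
    P (G `&` [set w | D (Y w, Z w)]) =
    finite_mixture c (fun i => pair_mixture (p i) (r i) E) D.
Proof.
move=> mG mY mZ p1 r1 rect D mD.
have mYZ : measurable_fun setT (fun w => (Y w, Z w)) by exact: measurable_fun_pair.
pose nu := measure_function_pushforward__canonical__measure_function_Measure
  (mrestr P mG) mYZ.
have nuE A : nu A = P (G `&` [set w | A (Y w, Z w)]).
  by rewrite /nu/= /pushforward /mrestr setIC.
rewrite -nuE; apply: rectangle_measure_unique => //.
  by rewrite nuE (le_lt_trans (probability_le1 _ _)) ?ltry// setIT.
move=> A B mA mB; rewrite nuE rect//; apply: eq_bigr => i _.
by rewrite /= pair_mixture_setX.
Qed.

(** * Vectors with mixed laws and their sums *)

Lemma measurable_forall (d : measure_display) (T : measurableType d) (K : finType)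
    (Q : K -> Prop) (A : K -> set T) :
  (forall k, measurable (A k)) -> measurable [set w | forall k, Q k -> A k w].
Proof.
move=> mA.
rewrite (_ : [set w | _] = \bigcap_(k in [set k | Q k]) A k); last first.
  by apply/seteqP; split => w /= h k; exact: h.
exact: fin_bigcap_measurable.
Qed.

Lemma measurable_preimage (d d' : measure_display) (T : measurableType d)
    (T' : measurableType d') (Y : T -> T') (A : set T') :
  measurable_fun setT Y -> measurable A -> measurable [set w | A (Y w)].
Proof. by move=> mY mA; rewrite -[X in measurable X]setTI; exact: mY. Qed.

Section mixed_law.
Variables (d : measure_display) (T : measurableType d) (R : realType).
Variables (P : probability T R) (F K : finType) (c : F -> {nonneg R}).
Variables (X : K -> T -> measurableTypeR R).
Hypothesis mX : forall k, measurable_fun setT (X k).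
Variables (p : F -> K -> nat -> {nonneg R}).
Hypothesis p1 : forall i k, weight_sum1 (p i k).
Variables (E : nat -> probability (measurableTypeR R) R).

Let update k0 (D : set (measurableTypeR R)) (B : K -> set (measurableTypeR R)) k :=
  if k == k0 then D else B k.

Let measurable_update k0 D B : measurable D -> (forall k, measurable (B k)) ->
  forall k, measurable (update k0 D B k).
Proof. by move=> mD mB k; rewrite /update; case: ifP. Qed.

Let box B : set T := [set w | forall k, B k (X k w)].

Let measurable_box B : (forall k, measurable (B k)) -> measurable (box B).
Proof.
move=> mB; have := @measurable_forall _ _ K (fun=> True) (fun k => [set w | B k (X k w)]).
rewrite (_ : [set w | _] = box B); last by apply/seteqP; split => w /= h k *; exact: h.
by apply => k; exact: measurable_preimage.
Qed.

Let weight B (Q : pred K) i := (\prod_(k | Q k) mixture (p i k) E (B k))%E.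

Let weightE B Q : (forall k, measurable (B k)) ->
  exists r : F -> {nonneg R}, forall i, (r i)%:num%:E = ((c i)%:num%:E * weight B Q i)%E.
Proof.
move=> mB.
have w0 i : (0 <= (c i)%:num%:E * weight B Q i)%E.
  by rewrite mule_ge0//; apply: prode_ge0 => k _.
exists (fun i => NngNum (fine_ge0 (w0 i))) => i /=; rewrite fineK// fin_numM//.
by apply: prode_fin_num => k _; exact: mixture_fin_num.
Qed.

Let weight_update k0 D B i :
  (weight (update k0 D B) xpredT i =
   mixture (p i k0) E D * weight B (fun k => k != k0) i)%E.
Proof.
rewrite /weight (bigD1 k0)//= /update eqxx; congr (_ * _)%E.
by apply: eq_bigr => k /negbTE ->.
Qed.

(** From joint cdfs to boxes with arbitrary Borel sides: the half-lines are
    replaced by Borel sets one coordinate at a time, since with the other sides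
    fixed both members are finite measures in the side that is replaced. *)
Lemma mixed_law_box :
  (forall x : K -> R, P [set w | forall k, X k w <= x k] =
     (\sum_i (c i)%:num%:E * \prod_k mixture (p i k) E `]-oo, x k]%classic)%E) ->
  forall B : K -> set (measurableTypeR R), (forall k, measurable (B k)) ->
    P [set w | forall k, B k (X k w)] =
    (\sum_i (c i)%:num%:E * \prod_k mixture (p i k) E (B k))%E.
Proof.
move=> half B mB.
suff : forall s : seq K, forall B : K -> set (measurableTypeR R),
    (forall k, measurable (B k)) ->
    (forall k, k \notin s -> exists x : R, B k = `]-oo, x]%classic) ->
    P (box B) = (\sum_i (c i)%:num%:E * weight B xpredT i)%E.
  by move/(_ (enum K) B mB); apply => k; rewrite mem_enum.
elim=> [|k0 s IH] {mB}B mB hB.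
  have [x xB] := choice (fun k => hB k isT).
  rewrite (_ : box B = [set w | forall k, X k w <= x k]); last first.
    apply/seteqP; split => w /= h k; have := h k; rewrite xB /= in_itv//=.
  by rewrite half; apply: eq_bigr => i _; congr (_ * _)%E; apply: eq_bigr => k _; rewrite xB.
have [r rE] := weightE (fun k => k != k0) mB.
pose G := [set w | forall k, k != k0 -> B k (X k w)].
have mG : measurable G.
  by apply: measurable_forall => k; exact: measurable_preimage.
pose nu := measure_function_pushforward__canonical__measure_function_Measure
  (mrestr P mG) (mX k0).
have nuE D : nu D = P (box (update k0 D B)).
  rewrite /nu/= /pushforward /mrestr; congr (P _); apply/seteqP; split => w /=.
    by move=> [wD wG] k; rewrite /update; case: eqP => [->//|/eqP]; exact: wG.
  move=> h; split; first by have := h k0; rewrite /update eqxx.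
  by move=> k kk0; have := h k; rewrite /update (negbTE kk0).
have -> : P (box B) = nu (B k0).
  rewrite nuE; congr (P (box _)); apply/funext => k; rewrite /update.
  by case: eqP => [->|].
rewrite (@halfline_measure_unique _ nu
   (finite_mixture r (fun i => mixture (p i k0) E)))//.
- apply: eq_bigr => i _; rewrite rE -muleA; congr (_ * _)%E.
  by rewrite muleC /weight [RHS](bigD1 k0).
- by rewrite nuE (le_lt_trans (probability_le1 _ _)) ?ltry//;
    apply: measurable_box; exact: (@measurable_update k0).
- move=> x; rewrite nuE IH.
  + by apply: eq_bigr => i _; rewrite weight_update/= rE -muleA [in RHS](muleC (weight _ _ _)).
  + exact: (@measurable_update k0).
  + move=> k ks; rewrite /update; case: eqP => [_|/eqP kk0]; first by exists x.
    by apply: hB; rewrite inE negb_or kk0.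
Qed.

Hypothesis law_box :
  forall B : K -> set (measurableTypeR R), (forall k, measurable (B k)) ->
    P [set w | forall k, B k (X k w)] =
    (\sum_i (c i)%:num%:E * \prod_k mixture (p i k) E (B k))%E.
Hypothesis EC : convolution_semigroup E.

(** The weights of the law of a sum of independent integer variables, one for
    each entry of [s]. *)
Definition sum_weight (q : K -> nat -> {nonneg R}) (s : seq K) : nat -> {nonneg R} :=
  foldr (fun k r => weight_conv (q k) r) (fun n => ((n == 0)%N%:R)%:nng) s.

Lemma sum_weight_sum1 (q : K -> nat -> {nonneg R}) (s : seq K) :
  (forall k, weight_sum1 (q k)) -> weight_sum1 (sum_weight q s).
Proof.
move=> q1; elim: s => [|k s IH] /=; last exact: weight_conv_sum1.
by rewrite /weight_sum1 nneseries_recl//= eseries0 ?adde0// => -[].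
Qed.

(** Summands are added one at a time. If the sides of [B] at the summed
    coordinates are full, then the induction hypothesis, used with the side at [k0]
    free, gives the law of the pair formed by [X k0] and the partial sum; its image
    under addition is computed by [pair_mixture_conv]. *)
Lemma mixed_law_sum (s : seq K) (B : K -> set (measurableTypeR R))
    (C : set (measurableTypeR R)) :
  uniq s -> (forall k, measurable (B k)) -> (forall k, k \in s -> B k = setT) ->
  measurable C ->
  P ([set w | forall k, B k (X k w)] `&` [set w | C (\sum_(k <- s) X k w)]) =
  (\sum_i (c i)%:num%:E * (\prod_k mixture (p i k) E (B k) *
     mixture (sum_weight (p i) s) E C))%E.
Proof.
have [E0 _] := EC.
elim: s B C => [|k0 s IH] B C.
  move=> _ mB _ mC.
  have mixE i : mixture (sum_weight (p i) [::]) E C = (\1_C (0 : R))%:E.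
    rewrite mixtureE nneseries_recl//.
    rewrite eseries0 ?adde0 /=; first by rewrite mul1e; exact: E0.
    by move=> -[//|n] _ _; rewrite mul0e.
  under [RHS]eq_bigr => i _ do rewrite mixE.
  rewrite (_ : [set w | C (\sum_(k <- [::]) X k w)] = [set _ | C 0]); last first.
    by apply/seteqP; split => w /=; rewrite big_nil.
  rewrite indicE; have [C0|C0] := boolP ((0 : R) \in C).
    rewrite (_ : [set _ | C 0] = setT) ?setIT; last first.
      by apply/seteqP; split => // w _ /=; rewrite inE in C0.
    by rewrite law_box//; apply: eq_bigr => i _; rewrite mule1.
  rewrite (_ : [set _ | C 0] = set0) ?setI0 ?measure0; last first.
    by apply/seteqP; split => // w /=; rewrite notin_setE in C0.
  by rewrite big1// => i _; rewrite !mule0.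
move=> /= /andP[k0s us] mB sB mC.
have [r rE] := weightE (fun k => k != k0) mB.
have Bk0 : B k0 = setT by apply: sB; rewrite inE eqxx.
have mS : measurable_fun setT (fun w => \sum_(k <- s) X k w).
  exact: measurable_sum.
have rect A D : measurable A -> measurable D ->
    P (box B `&` [set w | A (X k0 w) /\ D (\sum_(k <- s) X k w)]) =
    (\sum_i (r i)%:num%:E *
      (mixture (p i k0) E A * mixture (sum_weight (p i) s) E D))%E.
  move=> mA mD.
  rewrite (_ : _ `&` _ = box (update k0 A B) `&` [set w | D (\sum_(k <- s) X k w)]).
    rewrite IH//.
    - apply: eq_bigr => i _; rewrite -/(weight _ xpredT i) weight_update rE.
      by rewrite -!muleA; congr (_ * _)%E; rewrite muleCA.
    - exact: (@measurable_update k0).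
    - move=> k ks; rewrite /update; case: eqP => [kk0|_]; first by rewrite -kk0 ks in k0s.
      by apply: sB; rewrite inE ks orbT.
  apply/seteqP; split => w /=.
    move=> [wB [wA wD]]; split => // k; rewrite /update; case: eqP => [->//|_]; exact: wB.
  move=> [wB wD]; split; last by split => //; have := wB k0; rewrite /update eqxx.
  move=> k; have := wB k; rewrite /update; case: eqP => [-> _|//].
  by rewrite Bk0.
have := @pair_law _ _ _ P F r (fun i => p i k0) (fun i => sum_weight (p i) s) E (box B)
  (X k0) (fun w => \sum_(k <- s) X k w) (measurable_box mB) (mX k0) mS
  (fun i => p1 i k0) (fun i => sum_weight_sum1 s (p1 i)) rect _ (measurable_addr mC).
rewrite (_ : [set w | C (\sum_(k <- k0 :: s) X k w)] =
    [set w | C (X k0 w + \sum_(k <- s) X k w)]); last first.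
  by apply/seteqP; split => w /=; rewrite big_cons.
move=> ->; apply: eq_bigr => i _; rewrite /= rE pair_mixture_conv// -muleA.
congr (_ * (_ * _))%E; rewrite [RHS](bigD1 k0)//= Bk0.
rewrite (_ : mixture _ _ _ = 1%E) ?mul1e//.
rewrite mixtureE -[RHS](p1 i k0); apply: eq_eseriesr => n _.
by rewrite /= probability_setT mule1.
Qed.

End mixed_law.

(** * Mixed Erlang densities *)

Lemma poisson_weight_le1 (R : realType) (t : R) (n : nat) : 0 <= t ->
  poisson_weight t n <= 1.
Proof.
move=> t0; rewrite -lee_fin -(sum_poisson_weight t0).
apply: le_trans (@nneseries_lim_ge _ _ xpredT 0 n.+1 _); last first.
  by move=> i _ _; rewrite lee_fin poisson_weight_ge0.
rewrite big_nat_recr//= leeDr// sume_ge0// => i _.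
by rewrite lee_fin poisson_weight_ge0.
Qed.

Lemma erlang_pdf_le (R : realType) (b x : R) (n : nat) : 0 <= b ->
  erlang_pdf n.+1 b x <= b.
Proof.
move=> b0; have [x0|x0] := lerP 0 x; last by rewrite erlang_pdf_lt0.
by rewrite erlang_pdfE// ler_piMr// poisson_weight_le1// mulr_ge0.
Qed.

Definition mixed_erlang_pdf (R : realType) (b : R) (w : nat -> {nonneg R}) (x : R) : R :=
  fine (\sum_(0 <= n <oo) (w n)%:num%:E * (erlang_pdf n b x)%:E)%E.

Section mixed_erlang_pdf.
Variables (R : realType) (b : {posnum R}) (w : nat -> {nonneg R}).
Hypotheses (w1 : weight_sum1 w) (w0 : (w 0%N)%:num = 0).

Let bound n x : ((w n)%:num * erlang_pdf n b%:num x <= (w n)%:num * b%:num)%R.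
Proof.
case: n => [|n]; first by rewrite w0 !mul0r.
by rewrite ler_wpM2l// erlang_pdf_le.
Qed.

Lemma mixed_erlang_pdfE x : ((mixed_erlang_pdf b%:num w x)%:E =
  \sum_(0 <= n <oo) (w n)%:num%:E * (erlang_pdf n b%:num x)%:E)%E.
Proof.
rewrite /mixed_erlang_pdf fineK// ge0_fin_numE; last first.
  by apply: nneseries_ge0 => n _ _; rewrite mule_ge0// lee_fin erlang_pdf_ge0.
apply: (@le_lt_trans _ _ (\sum_(0 <= n <oo) b%:num%:E * (w n)%:num%:E)%E).
  apply: lee_nneseries => [n _ _|n _]; first by rewrite mule_ge0// lee_fin erlang_pdf_ge0.
  by rewrite muleC -!EFinM lee_fin mulrC [leRHS]mulrC bound.
by rewrite nneseriesZl// w1 mule1 ltry.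
Qed.

Lemma mixed_erlang_pdf_ge0 x : 0 <= mixed_erlang_pdf b%:num w x.
Proof.
rewrite -lee_fin mixed_erlang_pdfE nneseries_ge0// => n _ _.
by rewrite mule_ge0// lee_fin erlang_pdf_ge0.
Qed.

Lemma measurable_mixed_erlang_pdf : measurable_fun setT (mixed_erlang_pdf b%:num w).
Proof.
apply/measurable_EFinP; apply: (eq_measurable_fun (fun x =>
  \sum_(0 <= n <oo) (w n)%:num%:E * (erlang_pdf n b%:num x)%:E)%E).
  by move=> x _; rewrite /= mixed_erlang_pdfE.
apply: ge0_emeasurable_sum => [n x _ _|n _]; first by rewrite mule_ge0// lee_fin erlang_pdf_ge0.
apply: emeasurable_funM => //.
by apply/measurable_EFinP; exact: measurable_erlang_pdf.
Qed.

(** The series is an integral over [nat] with respect to the mixing law, and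
    its terms are continuous and bounded by the rate: the dominated convergence
    theorem applies. *)
Lemma continuous_mixed_erlang_pdf x : 0 < x ->
  {for x, continuous (mixed_erlang_pdf b%:num w)}.
Proof.
move=> x0.
pose mu := mixture w (fun n => \d_n : {measure set nat -> \bar R}).
have muT : mu setT = 1%E.
  rewrite /mu mixtureE -w1; apply: eq_eseriesr => n _.
  by rewrite /= diracT mule1.
pose f (y : R) (n : nat) : R := (if n is 0 then 0 else erlang_pdf n b%:num y).
have f0 y n : 0 <= f y n by case: n => //= n; exact: erlang_pdf_ge0.
have fb y n : f y n <= b%:num by case: n => //= n; exact: erlang_pdf_le.
have mf (h : nat -> \bar R) : measurable_fun setT h by [].
have int_b : mu.-integrable setT (EFin \o cst b%:num).
  apply/integrableP; split; first exact: mf.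
  under eq_integral => n _ do rewrite /= ger0_norm//.
  by rewrite integral_cst// [X in (_ * X)%E]muT mule1 ltry.
have fE : mixed_erlang_pdf b%:num w = (fun y => \int[mu]_n f y n).
  apply/funext => y; rewrite /mixed_erlang_pdf /Rintegral; congr fine.
  rewrite ge0_integral_mixture//; last by move=> n; rewrite lee_fin.
  apply: eq_eseriesr => n _.
  rewrite integral_dirac// diracT mul1e.
  by case: n => [|n] //=; rewrite w0 !mul0e.
rewrite fE.
have := @continuity_under_integral R _ nat mu f setT measurableT 0 (x + 1).
move=> /(_ _ _ _ int_b); apply.
- move=> y _; apply: le_integrable int_b => // n _ /=.
  by rewrite lee_fin !ger0_norm.
- apply: aeW => n _ y; rewrite inE/= in_itv/= => /andP[y0 _].
  case: n => [|n]; first exact: cst_continuous.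
  have [+ _] := (continuous_within_itvcyP _ _).1 (@within_continuous_erlang_pdf R b%:num n).
  by apply; rewrite in_itv/= y0.
- by move=> y _; apply: aeW => n _; rewrite ger0_norm.
- by rewrite inE/= in_itv/= x0 ltrDl ltr01.
Qed.

End mixed_erlang_pdf.

(** * Uniqueness of a continuous joint density *)

(** If [f z] exceeded [g z], then by continuity a level would separate [g] from
    [f] on a small square around [z], and the two integrals over this square could
    not both be its probability. *)
Lemma continuous_joint_density_le (R : realType) (d : measure_display)
    (T : measurableType d) (P : probability T R) (Y Z : T -> R)
    (f g : R * R -> R) (z : R * R) :
  continuous_joint_density P Y Z f -> continuous_joint_density P Y Z g ->
  0 < z.1 -> 0 < z.2 -> f z <= g z.
Proof.
move=> [[mf f0 fP] cf] [[mg g0 gP] cg] z1 z2; rewrite leNgt; apply/negP => gf.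
pose mid := (f z + g z) / 2.
have gm : g z < mid by rewrite /mid; lra.
have mf' : mid < f z by rewrite /mid; lra.
(* Near [z], [g] stays below a level lying strictly below [mid]. *)
have near_z : \forall y \near z, g y <= (g z + mid) / 2 /\ mid <= f y.
  near=> y; split; near: y.
    have gz : g y @[y --> z] --> g z by exact: cg.
    by apply: (cvgr_le _ gz); lra.
  have fz : f y @[y --> z] --> f z by exact: cf.
  exact: (cvgr_ge _ fz).
have [e /= e0 he] : exists2 e : R, 0 < e & forall y : R * R,
    `|z.1 - y.1| < e -> `|z.2 - y.2| < e -> g y <= (g z + mid) / 2 /\ mid <= f y.
  move/nbhs_ballP : near_z => [e /= e0 he]; exists e => // y y1 y2; apply: he.
  by split.
pose I (c : R) : set (measurableTypeR R) := `]c - e, c + e[%classic.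
have II c y : I c y -> `|c - y| < e.
  by rewrite /I/= in_itv/= ltr_distlC => /andP[-> ->].
pose leb2 := ((@lebesgue_measure R) \x (@lebesgue_measure R))%E.
have mA : measurable (I z.1 `*` I z.2) by apply: measurableX; exact: measurable_itv.
have muI c : lebesgue_measure (I c) = (2 * e)%:E.
  rewrite /I lebesgue_measure_itv/= lte_fin ltrD2l gtrN// -EFinB; congr EFin; ring.
have AE : leb2 (I z.1 `*` I z.2) = ((2 * e) * (2 * e))%:E.
  rewrite EFinM -{1}(muI z.1) -(muI z.2) /leb2.
  by apply: product_measure1E; exact: measurable_itv.
have m0 : 0 < 2 * e * (2 * e) by rewrite !mulr_gt0.
have lo : ((mid * (2 * e * (2 * e)))%:E <= \int[leb2]_(p in I z.1 `*` I z.2) (f p)%:E)%E.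
  rewrite EFinM -AE -integral_cst//; apply: ge0_le_integral => //.
  - by move=> p _; rewrite lee_fin (le_trans _ (ltW gm)).
  - by apply: measurable_funTS; exact/measurable_EFinP.
  - by move=> p [/II p1 /II p2]; rewrite lee_fin; exact: (he p p1 p2).2.
have up : (\int[leb2]_(p in I z.1 `*` I z.2) (g p)%:E <=
    (((g z + mid) / 2) * (2 * e * (2 * e)))%:E)%E.
  rewrite EFinM -AE -integral_cst//; apply: ge0_le_integral => //.
  - by move=> p _; rewrite lee_fin.
  - by apply: measurable_funTS; exact/measurable_EFinP.
  - by move=> p [/II p1 /II p2]; rewrite lee_fin; exact: (he p p1 p2).1.
have := le_trans lo; rewrite -fP// gP// => /(_ _ up).
rewrite lee_fin ler_pM2r// => h; lra.
Unshelve. all: by end_near. Qed.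

(** * Joint density and allocation of a mixed Erlang pair *)

(** After [mul_erlang_pdf] the integrand is a product of Erlang densities that
    vanishes outside the segment from 0 to [s]. *)
Lemma erlang_allocation (R : realType) (b s : R) (i j : nat) : 0 < b ->
  (\int[lebesgue_measure]_(x in `[0%R, s])
     (x * (erlang_pdf i.+1 b x * erlang_pdf j.+1 b (s - x)))%:E =
   (i.+1%:R / b * erlang_pdf (i + j).+3 b s)%:E)%E.
Proof.
move=> b0; rewrite EFinM -(@erlang_pdf_conv _ b s i.+1 j) ?ltW//.
rewrite -ge0_integralZl//; last 3 first.
- apply/measurable_EFinP; apply: measurable_funM; first exact: measurable_erlang_pdf.
  apply: measurableT_comp; first exact: measurable_erlang_pdf.
  exact: measurable_funB.
- by move=> x _; rewrite lee_fin mulr_ge0 ?erlang_pdf_ge0 ?ltW.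
- by rewrite lee_fin divr_ge0// ltW.
rewrite [LHS]integral_mkcond; apply: eq_integral => x _; rewrite patchE -EFinM.
rewrite [in RHS]mulrA -mul_erlang_pdf//.
case: ifPn => [_|]; first by rewrite mulrA.
rewrite notin_setE/= in_itv/= => /negP; rewrite negb_and -!ltNge => /orP[x0|x0].
  by rewrite erlang_pdf_lt0// mulr0 mul0r.
by rewrite [X in _ * X]erlang_pdf_lt0 ?mulr0// subr_lt0.
Qed.

(** Stated for positive shapes only, since the Dirac mass of shape 0 has no
    density. *)
Lemma erlang_law_prod_density (R : realType) (b : {posnum R}) (i j : nat)
    (D : set (measurableTypeR R * measurableTypeR R)) : measurable D ->
  ((erlang_law b i.+1 \x erlang_law b j.+1) D =
   \int[lebesgue_measure \x lebesgue_measure]_(z in D)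
     (erlang_pdf i.+1 b%:num z.1 * erlang_pdf j.+1 b%:num z.2)%:E)%E.
Proof.
move=> mD.
have mf : measurable_fun setT (fun z : measurableTypeR R * measurableTypeR R =>
    (erlang_pdf i.+1 b%:num z.1 * erlang_pdf j.+1 b%:num z.2)%:E).
  apply/measurable_EFinP; apply: measurable_funM.
    by apply: measurableT_comp; [exact: measurable_erlang_pdf|exact: measurable_fst].
  by apply: measurableT_comp; [exact: measurable_erlang_pdf|exact: measurable_snd].
rewrite integral_mkcond fubini_tonelli1; last 2 first.
- by apply/(measurable_restrictT _ mD); exact: measurable_funTS.
- by move=> z; rewrite patchE; case: ifP => // _; rewrite lee_fin mulr_ge0 ?erlang_pdf_ge0.
rewrite /product_measure1 ge0_integral_erlang_law//; last first.
  exact: measurable_fun_xsection.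
apply: eq_integral => x _; rewrite /fubini_F /= /erlang_law muleC.
rewrite -ge0_integralZl//; last 4 first.
- exact: measurable_xsection.
- by apply: measurable_funTS; apply/measurable_EFinP; exact: measurable_erlang_pdf.
- by move=> y _; rewrite lee_fin erlang_pdf_ge0.
- by rewrite lee_fin erlang_pdf_ge0.
rewrite [LHS]integral_mkcond; apply: eq_integral => y _.
rewrite !patchE mem_xsection.
by case: ifP => // _; rewrite EFinM.
Qed.

(** Both series come out of the integral by monotone convergence. With [phi]
    equal to 1 and the two projections this gives the density of a pair, and with
    [phi x = x] on an antidiagonal it gives an expected allocation. *)
Lemma integral_mixed_erlang_pdf (R : realType) (b : {posnum R})
    (p r : nat -> {nonneg R}) (d : measure_display) (T : measurableType d)
    (mu : {measure set T -> \bar R}) (D : set T) (phi u v : T -> R) :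
  weight_sum1 p -> weight_sum1 r -> (p 0%N)%:num = 0 -> (r 0%N)%:num = 0 ->
  measurable D -> measurable_fun setT phi -> measurable_fun setT u ->
  measurable_fun setT v -> (forall t, D t -> 0 <= phi t) ->
  (\int[mu]_(t in D) (phi t *
     (mixed_erlang_pdf b%:num p (u t) * mixed_erlang_pdf b%:num r (v t)))%:E =
   \sum_(0 <= n <oo) (p n)%:num%:E * \sum_(0 <= l <oo) (r l)%:num%:E *
     \int[mu]_(t in D) (phi t *
       (erlang_pdf n b%:num (u t) * erlang_pdf l b%:num (v t)))%:E)%E.
Proof.
move=> p1 r1 p0 r0 mD mphi mu_ mv phi0.
have mh n (w : T -> R) : measurable_fun setT w ->
    measurable_fun D (fun t => erlang_pdf n b%:num (w t)).
  move=> mw; apply: measurable_funTS.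
  by apply: measurableT_comp => //; exact: measurable_erlang_pdf.
have mphiD : measurable_fun D phi by exact: measurable_funTS.
have mr : measurable_fun D (fun t => mixed_erlang_pdf b%:num r (v t)).
  apply: measurable_funTS.
  by apply: measurableT_comp => //; exact: measurable_mixed_erlang_pdf.
pose f n t := (phi t * (erlang_pdf n b%:num (u t) * mixed_erlang_pdf b%:num r (v t)))%:E.
have f0 n t : D t -> (0 <= f n t)%E.
  by move=> Dt; rewrite lee_fin !mulr_ge0 ?phi0 ?erlang_pdf_ge0 ?mixed_erlang_pdf_ge0.
have mf n : measurable_fun D (f n).
  apply/measurable_EFinP; apply: measurable_funM => //.
  by apply: measurable_funM => //; exact: mh.
transitivity (\int[mu]_(t in D) \sum_(0 <= n <oo) ((p n)%:num%:E * f n t))%E.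
  apply: eq_integral => t; rewrite inE => Dt.
  rewrite mulrCA mulrC EFinM (mixed_erlang_pdfE _ p1 p0) -nneseriesZl; last first.
    by move=> n _; rewrite mule_ge0// lee_fin erlang_pdf_ge0.
  by apply: eq_eseriesr => n _; rewrite /f -!EFinM; congr EFin; ring.
rewrite integral_nneseries//; last 2 first.
- by move=> n; exact: emeasurable_funM.
- by move=> n t Dt; rewrite mule_ge0// f0.
apply: eq_eseriesr => n _; rewrite ge0_integralZl//; last by move=> t; exact: f0.
congr (_ * _)%E.
pose g l t := (phi t * (erlang_pdf n b%:num (u t) * erlang_pdf l b%:num (v t)))%:E.
have g0 l t : D t -> (0 <= g l t)%E.
  by move=> Dt; rewrite lee_fin !mulr_ge0 ?phi0 ?erlang_pdf_ge0.
have mg l : measurable_fun D (g l).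
  apply/measurable_EFinP; apply: measurable_funM => //.
  by apply: measurable_funM; exact: mh.
transitivity (\int[mu]_(t in D) \sum_(0 <= l <oo) ((r l)%:num%:E * g l t))%E.
  apply: eq_integral => t; rewrite inE => Dt.
  rewrite /f mulrA EFinM (mixed_erlang_pdfE _ r1 r0) -nneseriesZl; last first.
    by move=> l _; rewrite mule_ge0// lee_fin erlang_pdf_ge0.
  by apply: eq_eseriesr => l _; rewrite /g -!EFinM; congr EFin; ring.
rewrite integral_nneseries//; last 2 first.
- by move=> l; exact: emeasurable_funM.
- by move=> l t Dt; rewrite mule_ge0// g0.
by apply: eq_eseriesr => l _; rewrite ge0_integralZl//; move=> t; exact: g0.
Qed.

Section mixed_density.
Variables (R : realType) (b : {posnum R}).
Let leb2 := ((@lebesgue_measure R) \x (@lebesgue_measure R))%E.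
Let E n : probability (measurableTypeR R) R := erlang_law b n.

Let m1 (g : R -> R) : measurable_fun setT g ->
  measurable_fun setT (fun z : measurableTypeR R * measurableTypeR R => g z.1).
Proof. by move=> mg; apply: measurableT_comp => //; exact: measurable_fst. Qed.

Let m2 (g : R -> R) : measurable_fun setT g ->
  measurable_fun setT (fun z : measurableTypeR R * measurableTypeR R => g z.2).
Proof. by move=> mg; apply: measurableT_comp => //; exact: measurable_snd. Qed.

Lemma pair_mixture_density (p r : nat -> {nonneg R})
    (D : set (measurableTypeR R * measurableTypeR R)) :
  weight_sum1 p -> weight_sum1 r -> (p 0%N)%:num = 0 -> (r 0%N)%:num = 0 ->
  measurable D ->
  (pair_mixture p r E D = \int[leb2]_(z in D)
     (mixed_erlang_pdf b%:num p z.1 * mixed_erlang_pdf b%:num r z.2)%:E)%E.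
Proof.
move=> p1 r1 p0 r0 mD.
transitivity (\int[leb2]_(z in D) (1 *
  (mixed_erlang_pdf b%:num p z.1 * mixed_erlang_pdf b%:num r z.2))%:E)%E; last first.
  by apply: eq_integral => z _; rewrite mul1r.
rewrite (@integral_mixed_erlang_pdf _ _ _ _ _ _ leb2 D (fun=> 1) fst snd
  p1 r1 p0 r0 mD (measurable_cst _) measurable_fst measurable_snd (fun _ _ => ler01)).
rewrite /pair_mixture mixtureE; apply: eq_eseriesr => n _.
case: n => [|n]; first by rewrite p0 !mul0e.
congr (_ * _)%E; rewrite /= mixtureE; apply: eq_eseriesr => l _.
case: l => [|l]; first by rewrite r0 !mul0e.
congr (_ * _)%E; rewrite [LHS]erlang_law_prod_density//.
by apply: eq_integral => z _; rewrite mul1r.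
Qed.

Variables (F : finType) (c : F -> {nonneg R}) (p r : F -> nat -> {nonneg R}).
Hypotheses (p1 : forall i, weight_sum1 (p i)) (r1 : forall i, weight_sum1 (r i)).
Hypotheses (p0 : forall i, (p i 0%N)%:num = 0) (r0 : forall i, (r i 0%N)%:num = 0).

Definition mixed_joint_pdf (z : R * R) : R :=
  \sum_i (c i)%:num *
    (mixed_erlang_pdf b%:num (p i) z.1 * mixed_erlang_pdf b%:num (r i) z.2).

Lemma mixed_joint_pdf_ge0 z : 0 <= mixed_joint_pdf z.
Proof.
by apply: sumr_ge0 => i _; rewrite !mulr_ge0 ?mixed_erlang_pdf_ge0.
Qed.

Lemma mixed_joint_pdfP (d : measure_display) (T : measurableType d)
    (P : probability T R) (Y Z : T -> R) :
  (forall D : set (measurableTypeR R * measurableTypeR R), measurable D ->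
    P [set w | D (Y w, Z w)] =
    finite_mixture c (fun i => pair_mixture (p i) (r i) E) D) ->
  continuous_joint_density P Y Z mixed_joint_pdf.
Proof.
move=> law; split; [split|].
- apply: measurable_sum => i; apply: measurable_funM => //.
  exact: (measurable_funM (m1 (measurable_mixed_erlang_pdf b (p1 i) (p0 i)))
      (m2 (measurable_mixed_erlang_pdf b (r1 i) (r0 i)))).
- exact: mixed_joint_pdf_ge0.
- move=> D mD; rewrite law// /finite_mixture.
  under [RHS]eq_integral => z _ do rewrite -sumEFin.
  rewrite ge0_integral_sum//; last 2 first.
  + move=> i; apply: measurable_funTS; apply/measurable_EFinP; apply: measurable_funM => //.
    exact: (measurable_funM (m1 (measurable_mixed_erlang_pdf b (p1 i) (p0 i)))
      (m2 (measurable_mixed_erlang_pdf b (r1 i) (r0 i)))).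
  + by move=> i z _; rewrite lee_fin !mulr_ge0 ?mixed_erlang_pdf_ge0.
  apply: eq_bigr => i _; rewrite /= pair_mixture_density// -ge0_integralZl//.
  + apply: measurable_funTS; apply/measurable_EFinP.
    exact: (measurable_funM (m1 (measurable_mixed_erlang_pdf b (p1 i) (p0 i)))
      (m2 (measurable_mixed_erlang_pdf b (r1 i) (r0 i)))).
  + by move=> z _; rewrite lee_fin mulr_ge0 ?mixed_erlang_pdf_ge0.
- move=> z z1 z2.
  rewrite /mixed_joint_pdf.
  apply: cvg_big => //; first exact: add_continuous.
  move=> i _; apply: cvgMr.
  have ci (w : nat -> {nonneg R}) : weight_sum1 w -> (w 0%N)%:num = 0 -> forall x : R, 0 < x ->
      mixed_erlang_pdf b%:num w @ x --> mixed_erlang_pdf b%:num w x.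
    by move=> w1 w0 x x0; exact: continuous_mixed_erlang_pdf.
  apply: cvgM.
    apply: (@continuous_comp _ _ _ fst (mixed_erlang_pdf b%:num (p i))); first exact: cvg_fst.
    exact: ci.
  apply: (@continuous_comp _ _ _ snd (mixed_erlang_pdf b%:num (r i))); first exact: cvg_snd.
  exact: ci.
Qed.

Lemma expected_allocation_mixed (s : R) :
  expected_allocation mixed_joint_pdf s =
  (\sum_i (c i)%:num%:E * \sum_(0 <= n <oo) (p i n)%:num%:E *
     \sum_(0 <= l <oo) (r i l)%:num%:E *
       (n%:R / b%:num * erlang_pdf (n + l).+1 b%:num s)%:E)%E.
Proof.
rewrite /expected_allocation.
transitivity (\int[lebesgue_measure]_(x in `[0%R, s]) \sum_i ((c i)%:num%:E *
  (x * (mixed_erlang_pdf b%:num (p i) x * mixed_erlang_pdf b%:num (r i) (s - x)))%:E))%E.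
  apply: eq_integral => x _; rewrite /mixed_joint_pdf mulr_sumr -sumEFin.
  by apply: eq_bigr => i _ /=; rewrite -EFinM; congr EFin; ring.
have msub : measurable_fun setT (fun x : measurableTypeR R => s - x).
  exact: measurable_funB.
have mi i : measurable_fun setT (fun x : measurableTypeR R =>
   (x * (mixed_erlang_pdf b%:num (p i) x * mixed_erlang_pdf b%:num (r i) (s - x)))%:E).
  apply/measurable_EFinP; apply: measurable_funM => //; apply: measurable_funM.
    exact: measurable_mixed_erlang_pdf.
  by apply: measurableT_comp => //; exact: measurable_mixed_erlang_pdf.
have i0 i (x : R) : `[0, s]%classic x -> (0 <= (x *
    (mixed_erlang_pdf b%:num (p i) x * mixed_erlang_pdf b%:num (r i) (s - x)))%:E)%E.
  by rewrite /= in_itv/= => /andP[x0 _]; rewrite lee_fin !mulr_ge0 ?mixed_erlang_pdf_ge0.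
rewrite ge0_integral_sum//; last 2 first.
- by move=> i; apply: measurable_funTS; exact: emeasurable_funM.
- by move=> i x xs; rewrite mule_ge0// i0.
apply: eq_bigr => i _; rewrite ge0_integralZl//; last 2 first.
- exact: measurable_funTS.
- by move=> x; exact: i0.
congr (_ * _)%E; rewrite integral_mixed_erlang_pdf//; last first.
  by move=> x; rewrite /= in_itv/= => /andP[].
apply: eq_eseriesr => n _; case: n => [|n]; first by rewrite p0 !mul0e.
congr (_ * _)%E; apply: eq_eseriesr => l _; case: l => [|l]; first by rewrite r0 !mul0e.
by congr (_ * _)%E; rewrite erlang_allocation ?addnS ?addSn.
Qed.

End mixed_density.

(** * Tail allocation of an Erlang pair *)

(** Regrouping by the total shape [k]; the vanishing weights at 0 remove the
    indices [k < 2], [n = 0] and [n = k]. *)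
Lemma nneseries_allocation (R : realType) (p r : nat -> {nonneg R})
    (phi : nat -> nat -> \bar R) :
  (p 0%N)%:num = 0 -> (r 0%N)%:num = 0 -> (forall n k, 0 <= phi n k)%E ->
  (\sum_(0 <= n <oo) (p n)%:num%:E * \sum_(0 <= l <oo) (r l)%:num%:E * phi n (n + l)%N =
   \sum_(2 <= k <oo) \sum_(1 <= n < k)
     ((p n)%:num%:E * (r (k - n)%N)%:num%:E * phi n k))%E.
Proof.
move=> p0 r0 phi0.
pose u n l := ((p n)%:num%:E * (r l)%:num%:E * phi n (n + l)%N)%E.
have u0 n l : (0 <= u n l)%E by rewrite !mule_ge0.
transitivity (\sum_(0 <= n <oo) \sum_(0 <= l <oo) u n l)%E.
  apply: eq_eseriesr => n _; rewrite -nneseriesZl; last by move=> l _; rewrite mule_ge0.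
  by apply: eq_eseriesr => l _; rewrite muleA.
rewrite nneseries_diagonal// [RHS]nneseries_geq; apply: eq_eseriesr => -[|[|k]] _ /=.
- by rewrite big_nat1 /u p0 !mul0e.
- by rewrite big_nat_recr//= big_nat1 /u p0 r0 mule0 !mul0e adde0.
- rewrite big_nat_recr//= subnn /u r0 mule0 mul0e adde0 big_ltn// p0 !mul0e add0e.
  by rewrite !big_nat; apply: eq_bigr => n /andP[_ nk]; rewrite subnKC// ltnW.
Qed.

Lemma measurable_pair_tail (R : realType) (s : R) :
  measurable_fun setT (fun z : measurableTypeR R * measurableTypeR R =>
    ((Num.max z.1 0)%:E * (\1_[set z : R * R | s < z.1 + z.2] z)%:E)%E).
Proof.
apply: emeasurable_funM; apply/measurable_EFinP.
  by apply: measurable_maxr => //; exact: measurable_fst.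
apply: measurable_indic.
rewrite (_ : mkset _ = [set z : R * R | `]s, +oo[%classic (z.1 + z.2)]).
  by apply: measurable_addr; exact: measurable_itv.
by apply/seteqP; split => z /=; rewrite in_itv/= andbT.
Qed.

(** Integrating first along the second coordinate, [erlang_law_moment] trades
    the factor [z.1] for one more unit of shape, and what remains is the law of a
    sum. *)
Lemma erlang_law_tail_moment (R : realType) (b : {posnum R}) (n l : nat) (s : R) :
  (\int[erlang_law b n \x erlang_law b l]_z
     ((Num.max z.1 0)%:E * (\1_[set z : R * R | s < z.1 + z.2] z)%:E) =
   (n%:R / b%:num * erlang_ccdf (n + l).+1 b%:num s)%:E)%E.
Proof.
have mB : measurable (`]s, +oo[%classic : set (measurableTypeR R)) by exact: measurable_itv.
have setE : [set z : R * R | s < z.1 + z.2] = [set z : R * R | `]s, +oo[%classic (z.1 + z.2)].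
  by apply/seteqP; split => z /=; rewrite in_itv/= andbT.
rewrite fubini_tonelli1; last 2 first.
- exact: measurable_pair_tail.
- by move=> z; rewrite mule_ge0// lee_fin// le_max lexx orbT.
have mX := measurable_addr mB.
pose psi x := erlang_law b l (xsection [set z : R * R | s < z.1 + z.2] x).
have mpsi : measurable_fun setT psi.
  rewrite /psi setE.
  exact: (@measurable_fun_xsection _ _ (measurableTypeR R) (measurableTypeR R) R (erlang_law b l)).
transitivity (\int[erlang_law b n]_x ((Num.max x 0)%:E * psi x))%E.
  apply: eq_integral => x _; rewrite /fubini_F/=.
  have mS : measurable (xsection [set z : R * R | s < z.1 + z.2] x : set (measurableTypeR R)).
    by rewrite setE; exact: measurable_xsection.
  transitivity (\int[erlang_law b l]_y ((Num.max x 0)%:E *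
      (\1_(xsection [set z : R * R | s < z.1 + z.2] x) y)%:E))%E.
    by apply: eq_integral => y _; rewrite !indicE mem_xsection.
  rewrite ge0_integralZl//; last 2 first.
  - by apply/measurable_EFinP; exact: measurable_indic.
  - by rewrite lee_fin le_max lexx orbT.
  by rewrite integral_indic// setIT.
rewrite erlang_law_moment//.
rewrite [RHS]EFinM erlang_ccdfE//; congr (_ * _)%E.
rewrite -[(n + l).+1]/(n.+1 + l)%N -(erlang_law_conv b n.+1 l mB).
by rewrite /psi setE.
Qed.

(** * Discrete random variables *)

Lemma sum_pmf_nat (d : measure_display) (T : measurableType d) (R : realType)
    (P : probability T R) (N : T -> nat) (B : set nat) :
  measurable_fun setT N ->
  (P [set w | B (N w)] =
   \sum_(0 <= n <oo) P [set w | N w = n] * (\1_B n)%:E)%E.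
Proof.
move=> mN.
have mA n : measurable [set w | N w = n].
  exact: (@measurable_preimage _ _ _ _ N [set n] mN).
transitivity (\sum_(0 <= n <oo) P ([set w | N w = n] `&` [set w | B (N w)]))%E.
  have mNB n : measurable ([set w | N w = n] `&` [set w | B (N w)]).
    apply: measurableI => //.
    exact: (@measurable_preimage _ _ _ _ N B mN).
  rewrite -measure_semi_bigcup//.
  - congr (P _); apply/seteqP; split => [w Bw|w [n _ []]//].
    by exists (N w).
  - move=> i j _ _ [w [[<- _] [<- _]]] //.
  - exact: bigcup_measurable.
apply: eq_eseriesr => n _; rewrite indicE; have [Bn|Bn] := boolP (n \in B).
  rewrite mule1; congr (P _); apply/seteqP; split => [w []//|w /= wn].
  by split => //; rewrite wn; rewrite inE in Bn.
rewrite mule0 (_ : _ `&` _ = set0) ?measure0//.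
by apply/seteqP; split => // w [/= ->]; rewrite notin_setE in Bn.
Qed.

Lemma measurable_boolvec (d : measure_display) (T : measurableType d) (R : realType)
    (P : probability T R) (k : nat) (I : 'I_k -> {RV P >-> bool}) (i : 'I_k -> bool) :
  measurable [set w | forall j, I j w = i j].
Proof.
have := @measurable_forall _ _ _ (fun=> True) (fun j => [set w | I j w = i j]).
rewrite (_ : [set w | _] = [set w | forall j, I j w = i j]).
  by apply => j; exact: (@measurable_preimage _ _ _ _ (I j) [set i j]).
by apply/seteqP; split => w /= h j *; exact: h.
Qed.

Lemma expectation_boolvec (d : measure_display) (T : measurableType d) (R : realType)
    (P : probability T R) (k : nat) (I : 'I_k -> {RV P >-> bool})
    (g : ('I_k -> bool) -> R) :
  (forall i, 0 <= g i) ->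
  ('E_P[fun w => g (fun j => I j w)] =
   \sum_(i : {ffun 'I_k -> bool}) vector_pmf I i * (g i)%:E)%E.
Proof.
move=> g0.
have mI (i : {ffun 'I_k -> bool}) : measurable [set w | forall j, I j w = i j].
  exact: measurable_boolvec.
rewrite unlock.
transitivity (\int[P]_w \sum_(i : {ffun 'I_k -> bool})
   ((g i)%:E * (\1_[set w | forall j, I j w = i j] w)%:E))%E.
  apply: eq_integral => w _.
  pose i0 := [ffun j => I j w].
  rewrite (bigD1 i0)//= big1 ?adde0.
    rewrite indicE mem_set ?mule1; last by move=> j /=; rewrite ffunE.
    by congr ((g _)%:E); apply/funext => j; rewrite ffunE.
  move=> i ii0; rewrite indicE memNset ?mule0//= => h.
  by move/eqP : ii0; apply; apply/ffunP => j; rewrite ffunE h.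
rewrite ge0_integral_sum//; last 2 first.
- move=> i; apply: emeasurable_funM => //; apply/measurable_EFinP; exact: measurable_indic.
- by move=> i w _; rewrite mule_ge0// lee_fin.
apply: eq_bigr => i _; rewrite ge0_integralZl//; last 2 first.
- by apply/measurable_EFinP; exact: measurable_indic.
- by rewrite lee_fin.
by rewrite integral_indic// setIT muleC.
Qed.

Lemma order_unif_cdf_ge0 (R : realType) (o : bool) (u : R) : 0 <= u <= 1 ->
  0 <= order_unif_cdf o u.
Proof.
move=> /andP[u0 u1]; case: o => /=; first exact: sqr_ge0.
by rewrite subr_ge0 expr_le1 ?subr_ge0// gerBl.
Qed.

Lemma represents_sum (d : measure_display) (T : measurableType d) (R : realType)
    (P : probability T R) (k : nat) (I : 'I_k -> {RV P >-> bool})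
    (C : ('I_k -> R) -> R) (u : 'I_k -> R) :
  represents I C -> (forall j, 0 <= u j <= 1) ->
  ((C u)%:E = \sum_(i : {ffun 'I_k -> bool}) vector_pmf I i *
     (\prod_j order_unif_cdf (i j) (u j))%:E)%E.
Proof.
move=> repr u01; rewrite repr//.
apply: (@expectation_boolvec _ _ _ P k I (fun i => \prod_j order_unif_cdf (i j) (u j))).
by move=> i; apply: prodr_ge0 => j _; exact: order_unif_cdf_ge0.
Qed.

Definition pmf_weight (d : measure_display) (T : measurableType d) (R : realType)
    (P : probability T R) (N : T -> nat) (n : nat) : {nonneg R} :=
  NngNum (fine_ge0 (measure_ge0 P [set w | N w = n])).

Section pmf_weight.
Variables (d : measure_display) (T : measurableType d) (R : realType).
Variables (P : probability T R) (N : T -> nat).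
Hypothesis mN : measurable_fun setT N.

Lemma pmf_weightE n : (pmf_weight P N n)%:num%:E = P [set w | N w = n].
Proof.
rewrite /= fineK// fin_num_measure//.
exact: (@measurable_preimage _ _ _ _ N [set n] mN).
Qed.

Lemma pmf_weight_sum1 : weight_sum1 (pmf_weight P N).
Proof.
rewrite /weight_sum1 -(@probability_setT _ _ _ P).
rewrite [RHS](_ : _ = P [set w | setT (N w)]); last by congr (P _); apply/seteqP.
rewrite (@sum_pmf_nat _ _ _ _ _ setT mN); apply: eq_eseriesr => n _.
by rewrite pmf_weightE indicT mule1.
Qed.

(** A random integer has the mixture of Dirac masses weighted by its mass
    function as its law. *)
Lemma mixture_pmf_weight (B : set (measurableTypeR R)) :
  mixture (pmf_weight P N) (fun n => \d_(n%:R : measurableTypeR R)) B =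
  P [set w | B (N w)%:R].
Proof.
rewrite mixtureE (@sum_pmf_nat _ _ _ P N [set n | B n%:R])//.
by apply: eq_eseriesr => n _; rewrite pmf_weightE; congr (_ * _)%E.
Qed.

End pmf_weight.

Lemma dirac_convolution_semigroup (R : realType) :
  convolution_semigroup (fun n => \d_(n%:R : measurableTypeR R) : probability _ R).
Proof.
split => [A mA|i j B mB]; first by rewrite /= diracE indicE.
rewrite /product_measure1 integral_dirac//; last first.
  apply: (@measurable_fun_xsection _ _ (measurableTypeR R) (measurableTypeR R)).
  exact: measurable_addr.
rewrite diracT mul1e /= !diracE; congr ((nat_of_bool _)%:R%:E).
by rewrite mem_xsection; apply/idP/idP; rewrite !inE/= natrD.
Qed.

(** The Dirac masses at the integers form a convolution semigroup, so this is
    [mixed_law_sum] with a single mixture component. Thus the weights that appear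
    in the law of a sum of mixed Erlang variables are the mass function of a sum of
    integer variables. *)
Lemma independent_sum_pmf (d : measure_display) (T : measurableType d) (R : realType)
    (P : probability T R) (K : finType) (N : K -> {RV P >-> nat}) (s : seq K) (n : nat) :
  mutually_independent N -> uniq s ->
  P [set w | (\sum_(k <- s) N k w)%N = n] =
  (sum_weight (fun k => pmf_weight P (N k)) s n)%:num%:E.
Proof.
move=> indep us.
pose X k w : measurableTypeR R := (N k w)%:R.
have mN k : measurable_fun setT (N k) by exact: measurable_funPT.
have mX k : measurable_fun setT (X k).
  have mnat : measurable_fun setT (fun n : nat => n%:R : measurableTypeR R) by [].
  exact: (measurableT_comp mnat (mN k)).
pose E (n : nat) : probability (measurableTypeR R) R := \d_(n%:R : measurableTypeR R).
have law B : (forall k, measurable (B k)) -> P [set w | forall k, B k (X k w)] =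
    (\sum_(i : unit) 1%:nng%:num%:E * \prod_k mixture (pmf_weight P (N k)) E (B k))%E.
  move=> mB; rewrite (big_pred1 tt); last by case.
  rewrite mul1e.
  have := indep [set: K]%SET (fun k => [set j | B k j%:R]) (fun k => I).
  rewrite (_ : [set w | _] = [set w | forall k, B k (X k w)]); last first.
    by apply/seteqP; split => w /= h k *; apply: h; rewrite inE.
  move=> ->; apply: eq_big => [k|k _]; first by rewrite inE.
  by rewrite mixture_pmf_weight.
have := @mixed_law_sum _ _ _ P unit K (fun=> 1%:nng) X mX
  (fun _ k => pmf_weight P (N k)) (fun _ k => pmf_weight_sum1 P (mN k)) E law
  (dirac_convolution_semigroup R) s (fun=> setT) [set (n%:R : measurableTypeR R)] us
  (fun=> measurableT) (fun _ _ => erefl) (measurable_set1 _).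
rewrite (_ : [set w | forall k, setT (X k w)] = setT) ?setTI; last exact/seteqP.
rewrite (big_pred1 tt); last by case.
rewrite mul1e [X in (X * _)%E]big1 ?mul1e; last first.
  move=> k _; rewrite mixture_pmf_weight// -[RHS](@probability_setT _ _ _ P).
  by congr (P _); exact/seteqP.
rewrite (_ : [set w | _] = [set w | (\sum_(k <- s) N k w)%N = n]); last first.
  apply/seteqP; split => w /=; rewrite -natr_sum.
    by move/eqP; rewrite eqr_nat => /eqP.
  by move=> ->.
move=> ->; rewrite mixtureE.
rewrite (@nneseriesD1 _ _ n xpredT)//.
rewrite /E /= diracE mem_set// mule1 eseries0 ?adde0// => k _ kn.
by rewrite diracE memNset ?mule0//= => /eqP; rewrite eqr_nat (negbTE kn).
Qed.

(** * The two allocations *)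

Lemma erlang_cdf0 (R : realType) (b : {posnum R}) (n : nat) : (1 <= n)%N ->
  erlang_cdf n b%:num 0 = 0.
Proof.
case: n => // n _; apply: EFin_inj; rewrite erlang_cdfE// /erlang_law.
by rewrite integral_erlang_pdf_itv// mulr0 sum_poisson_weight0 subrr.
Qed.

(** Negative arguments are included, where both sides vanish, because a joint
    law is determined by its cdf on the whole space. *)
Lemma mixture_order_weight (R : realType) (b b2 : {posnum R}) (q : nat -> R)
    (o : bool) (w : nat -> {nonneg R}) (d : measure_display) (T : measurableType d)
    (P : probability T R) (X : {RV P >-> R}) (x : R) :
  b2%:num = 2 * b%:num -> probability_weights q ->
  (w 0%N)%:num = 0 -> (forall n, (1 <= n)%N -> (w n)%:num = order_weight q o n) ->
  (forall y, 0 <= y ->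
     cdf X y = (\sum_(1 <= n <oo) (q n * erlang_cdf n b%:num y)%:E)%E) ->
  mixture w (erlang_law b2) `]-oo, x]%classic = (order_unif_cdf o (fine (cdf X x)))%:E.
Proof.
move=> bb hq w0 wq XE.
have [x0|x0] := lerP 0 x.
  rewrite -(@order_weight_cdf _ b b2 q o x)// ?fineK ?XE//; last first.
    by rewrite -XE// fin_num_measure.
  rewrite mixtureE nneseries_recl// w0 mul0e add0e [LHS]nneseries_geq [RHS]nneseries_geq.
  by apply: eq_eseriesr => n _; case: ifP => // n1; rewrite wq.
have -> : cdf X x = 0%E.
  apply/eqP; rewrite eq_le cdf_ge0 andbT (le_trans (cdf_nondecreasing _ (ltW x0)))// XE//.
  by rewrite eseries0// => n n1 _; rewrite erlang_cdf0 ?mulr0.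
rewrite mixtureE eseries0; last by move=> n _ _; rewrite /= erlang_law_lt0// mule0.
by case: o {wq} => /=; rewrite ?expr0n// subr0 expr1n subrr.
Qed.

(** The expectation depends on the law of the pair only, and the first
    coordinate may be replaced by its positive part. *)
Lemma tail_expectation_mixed (R : realType) (b : {posnum R}) (d : measure_display)
    (T : measurableType d) (P : probability T R) (F : finType) (c : F -> {nonneg R})
    (p r : F -> nat -> {nonneg R}) (Y Z : T -> measurableTypeR R) (s : R) :
  measurable_fun setT Y -> measurable_fun setT Z -> P [set w | Y w < 0] = 0%E ->
  (forall D : set (measurableTypeR R * measurableTypeR R), measurable D ->
    P [set w | D (Y w, Z w)] =
    finite_mixture c (fun i => pair_mixture (p i) (r i) (erlang_law b)) D) ->
  ('E_P[fun w => (Y w * \1_[set w' | s < Y w' + Z w'] w)%R] =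
   \sum_i (c i)%:num%:E * \sum_(0 <= n <oo) (p i n)%:num%:E *
     \sum_(0 <= l <oo) (r i l)%:num%:E *
       (n%:R / b%:num * erlang_ccdf (n + l).+1 b%:num s)%:E)%E.
Proof.
move=> mY mZ Y0 law.
pose Phi (z : measurableTypeR R * measurableTypeR R) :=
  ((Num.max z.1 0)%:E * (\1_[set z : R * R | s < z.1 + z.2] z)%:E)%E.
have mPhi : measurable_fun setT Phi by exact: measurable_pair_tail.
have Phi0 z : (0 <= Phi z)%E by rewrite mule_ge0// lee_fin// le_max lexx orbT.
have mYZ : measurable_fun setT (fun w => (Y w, Z w)) by exact: measurable_fun_pair.
pose nu := measure_function_pushforward__canonical__measure_function_Measure P mYZ.
transitivity (\int[P]_w Phi (Y w, Z w))%E.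
  rewrite unlock; apply: ae_eq_integral => //.
  - apply/measurable_EFinP; apply: measurable_funM => //; apply: measurable_indic.
    rewrite (_ : mkset _ = [set w | `]s, +oo[%classic (Y w + Z w)]); last first.
      by apply/seteqP; split => w /=; rewrite in_itv/= andbT.
    apply: (@measurable_preimage _ _ _ (measurableTypeR R) (fun w => Y w + Z w)).
      exact: measurable_funD.
    exact: measurable_itv.
  - exact: measurableT_comp.
  - exists [set w | Y w < 0]; split => //.
    + rewrite (_ : mkset _ = [set w | `]-oo, (0 : R)[%classic (Y w)]); last first.
        by apply/seteqP; split => w /=; rewrite in_itv.
      by apply: measurable_preimage => //; exact: measurable_itv.
    + move=> w /= h; rewrite ltNge; apply/negP => Yw; apply: h => _.
      by rewrite /Phi/= max_l// EFinM; congr (_ * _%:E)%E.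
transitivity (\int[nu]_z Phi z)%E.
  by rewrite ge0_integral_pushforward.
rewrite (eq_measure_integral (finite_mixture c
  (fun i => pair_mixture (p i) (r i) (erlang_law b)))); last first.
  by move=> D mD _; exact: law.
rewrite ge0_integral_finite_mixture//; apply: eq_bigr => i _; congr (_ * _)%E.
rewrite [LHS]ge0_integral_mixture//; apply: eq_eseriesr => n _; congr (_ * _)%E.
rewrite [LHS]ge0_integral_mixture//; apply: eq_eseriesr => l _; congr (_ * _)%E.
exact: erlang_law_tail_moment.
Qed.

Theorem proposition3
  (R : realType) (d : nat) (d_ge2 : (2 <= d)%N)
  (beta : R) (beta_gt0 : 0 < beta)
  (q : 'I_d -> nat -> R)
  (q_prob : forall k, probability_weights (q k))
  (C : ('I_d -> R) -> R) (C_fgm : fgm_copula C)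
  (dispX : measure_display) (TX : measurableType dispX)
  (PX : probability TX R) (X : 'I_d -> {RV PX >-> R})
  (X_marginal : forall (k : 'I_d) (x : R), 0 <= x ->
     cdf (X k) x = (\sum_(1 <= j <oo) (q k j * erlang_cdf j beta x)%:E)%E)
  (X_joint : forall x : 'I_d -> R,
     PX [set w | forall k, X k w <= x k] =
     (C (fun k => fine (cdf (X k) (x k))))%:E)
  (dispI : measure_display) (TI : measurableType dispI)
  (PI : probability TI R) (I : 'I_d -> {RV PI >-> bool})
  (I_bern : symmetric_bernoulli I) (I_repr : represents I C)
  (dispL : measure_display) (TL : measurableType dispL)
  (PL : probability TL R) (L : 'I_d -> bool -> {RV PL >-> nat})
  (L_ge1 : forall k b w, (1 <= L k b w)%N)
  (L_pmf : forall k b j, (1 <= j)%N ->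
     PL [set w | L k b w = j] = (order_weight (q k) b j)%:E)
  (L_indep : forall i : 'I_d -> bool,
     mutually_independent (fun k => L k (i k)))
  (m : 'I_d) :
  let Sm w := \sum_(k < d | k != m) X k w in
  let S w := \sum_(k < d) X k w in
  [/\ exists f : R * R -> R, continuous_joint_density PX (X m) Sm f,
      forall f : R * R -> R, continuous_joint_density PX (X m) Sm f ->
      forall s : R, 0 <= s ->
        expected_allocation f s =
        (\sum_(i : {ffun 'I_d -> bool}) vector_pmf I i *
           \sum_(2 <= l <oo) \sum_(1 <= ell < l)
             (PL [set w | L m (i m) w = ell] *
              PL [set w | (\sum_(k < d | k != m) L k (i k) w)%N = (l - ell)%N] *
              (ell%:R / (2 * beta) * erlang_pdf l.+1 (2 * beta) s)%:E))%E
    & forall s : R, 0 <= s ->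
        ('E_PX[fun w => (X m w * \1_[set w' | s < S w'] w)%R] =
        \sum_(i : {ffun 'I_d -> bool}) vector_pmf I i *
           \sum_(2 <= l <oo) \sum_(1 <= ell < l)
             (PL [set w | L m (i m) w = ell] *
              PL [set w | (\sum_(k < d | k != m) L k (i k) w)%N = (l - ell)%N] *
              (ell%:R / (2 * beta) * erlang_ccdf l.+1 (2 * beta) s)%:E))%E ].
Proof.
move=> Sm S.
have b2_gt0 : 0 < 2 * beta by rewrite mulr_gt0.
pose b := PosNum beta_gt0; pose b2 := PosNum b2_gt0.
pose F := {ffun 'I_d -> bool}.
pose c (i : F) : {nonneg R} :=
  NngNum (fine_ge0 (measure_ge0 PI [set w | forall k, I k w = i k])).
have cE i : (c i)%:num%:E = vector_pmf I i.
  by rewrite /= fineK// fin_num_measure//; exact: measurable_boolvec.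
(* Reading the weights off the law of [L] lets the sum of the [L k] produce
   the weights of the sum of the [X k]. *)
pose p (i : F) k := @pmf_weight _ _ R PL (L k (i k)).
have mL k o : measurable_fun setT (L k o) by exact: measurable_funPT.
have p1 i k : weight_sum1 (p i k) by exact: pmf_weight_sum1.
have p0 i k : (p i k 0%N)%:num = 0.
  apply: EFin_inj; rewrite pmf_weightE// (_ : [set w | _] = set0) ?measure0//.
  by apply/seteqP; split => // w /= Lw; have := L_ge1 k (i k) w; rewrite Lw.
(* The coordinates that are summed, in the order in which big operators list them. *)
pose s0 := [seq k <- index_enum 'I_d | k != m].
have us0 : uniq s0 by rewrite filter_uniq// index_enum_uniq.
pose r (i : F) := sum_weight (p i) s0.
have r1 i : weight_sum1 (r i) by exact: sum_weight_sum1.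
have rE i n : (r i n)%:num%:E = PL [set w | (\sum_(k < d | k != m) L k (i k) w)%N = n].
  rewrite -(independent_sum_pmf n (L_indep i) us0).
  by congr (PL _); apply/seteqP; split => w /=; rewrite big_filter.
(* Some coordinate is summed, so that no Dirac mass at 0 remains in the sum. *)
have [k0 k0m] : exists k : 'I_d, k != m.
  have [m0|m0] := eqVneq (m : nat) 0%N.
    by exists (Ordinal d_ge2); apply/eqP => /(congr1 val) /=; rewrite m0.
  exists (Ordinal (ltnW d_ge2)); apply: contraNneq m0 => <-//.
have r0 i : (r i 0%N)%:num = 0.
  apply: EFin_inj; rewrite rE (_ : [set w | _] = set0) ?measure0//.
  apply/seteqP; split => // w /=; rewrite (bigD1 k0)//= => /eqP.
  by rewrite addn_eq0 => /andP[/eqP L0]; have := L_ge1 k0 (i k0) w; rewrite L0.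
have mX k : measurable_fun setT (X k : TX -> measurableTypeR R).
  exact: (@measurable_funPT _ _ _ _ (X k)).
pose E n : probability (measurableTypeR R) R := erlang_law b2 n.
have EC : convolution_semigroup E.
  split => [A mA|i j B mB]; first by rewrite /E/= /erlang_law diracE indicE.
  exact: erlang_law_conv.
(* Given [I], the joint cdf factors into the cdfs of minima and maxima. *)
have half_law (x : 'I_d -> R) : PX [set w | forall k, X k w <= x k] =
    (\sum_i (c i)%:num%:E * \prod_k mixture (p i k) E `]-oo, x k]%classic)%E.
  rewrite X_joint (represents_sum I_repr); last first.
    move=> k; rewrite fine_ge0//= -lee_fin fineK ?fin_num_measure// cdf_le1//.
  apply: eq_bigr => i _; rewrite cE -prodEFin; congr (_ * _)%E.
  apply: eq_bigr => k _; apply/esym.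
  apply: (@mixture_order_weight _ b b2 (q k)) => // n n1.
    by apply: EFin_inj; rewrite pmf_weightE// L_pmf.
  exact: X_marginal.
have box := mixed_law_box mX p1 half_law.
have mSm : measurable_fun setT (Sm : TX -> measurableTypeR R).
  by rewrite /Sm; under eq_fun do rewrite -big_filter; exact: measurable_sum.
have law : forall D : set (measurableTypeR R * measurableTypeR R), measurable D ->
    PX [set w | D (X m w, Sm w)] =
    finite_mixture c (fun i => pair_mixture (p i m) (r i) E) D.
  move=> D mD.
  have := @pair_law _ _ _ PX F c (fun i => p i m) r E setT (X m) Sm measurableT
    (mX m) mSm (fun i => p1 i m) r1.
  move=> /(_ _ D mD); rewrite setTI; apply => A B mA mB.
  (* Full sides at the summed coordinates leave only the side of [X m]. *)
  pose side k := if k == m then A else setT.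
  have := @mixed_law_sum _ _ _ PX F 'I_d c X mX p p1 E box EC s0 side B us0.
  rewrite setTI (_ : [set w | A (X m w) /\ B (Sm w)] =
    [set w | forall k, side k (X k w)] `&` [set w | B (\sum_(k <- s0) X k w)]); last first.
    apply/seteqP; split => w /=; rewrite big_filter => -[wA wB]; split => //.
      by move=> k; rewrite /side; case: eqP => // ->.
    by have := wA m; rewrite /side eqxx.
  move=> -> //.
  - apply: eq_bigr => i _; congr (_ * (_ * _))%E.
    rewrite (bigD1 m)//= {1}/side eqxx big1 ?mule1// => k /negbTE km.
    rewrite /side km mixtureE -[RHS](p1 i k); apply: eq_eseriesr => n _.
    by rewrite /= probability_setT mule1.
  - by move=> k; rewrite /side; case: ifP.
  - by move=> k; rewrite mem_filter /side => /andP[/negbTE ->].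
have densf0 : continuous_joint_density PX (X m) Sm
    (mixed_joint_pdf b2 c (fun i => p i m) r).
  by apply: mixed_joint_pdfP.
have reindex (phi : nat -> nat -> R) : (forall n k, 0 <= phi n k) ->
    (\sum_i (c i)%:num%:E * \sum_(0 <= n <oo) (p i m n)%:num%:E *
       \sum_(0 <= l <oo) (r i l)%:num%:E * (phi n (n + l)%N)%:E =
     \sum_(i : {ffun 'I_d -> bool}) vector_pmf I i *
       \sum_(2 <= l <oo) \sum_(1 <= ell < l)
         (PL [set w | L m (i m) w = ell] *
          PL [set w | (\sum_(k < d | k != m) L k (i k) w)%N = (l - ell)%N] *
          (phi ell l)%:E))%E.
  move=> phi0; apply: eq_bigr => i _; rewrite cE; congr (_ * _)%E.
  rewrite (@nneseries_allocation _ (p i m) (r i) (fun n k => (phi n k)%:E))//.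
  apply: eq_eseriesr => l _; rewrite !big_nat; apply: eq_bigr => ell _.
  by rewrite rE pmf_weightE.
split.
- by exists (mixed_joint_pdf b2 c (fun i => p i m) r).
- move=> f densf s s_ge0.
  rewrite -(reindex (fun n k => n%:R / (2 * beta) * erlang_pdf k.+1 (2 * beta) s)); last first.
    by move=> n k; rewrite mulr_ge0 ?erlang_pdf_ge0 ?divr_ge0 ?(ltW b2_gt0).
  rewrite -(@expected_allocation_mixed _ b2 _ c (fun i => p i m) r (fun i => p1 i m) r1
    (fun i => p0 i m) r0 s).
  have malloc g : continuous_joint_density PX (X m) Sm g ->
      measurable_fun `]0, s[ (fun x : R => x * g (x, s - x)).
    move=> [[mg _ _] _]; apply: measurable_funTS; apply: measurable_funM => //.
    apply: (@measurableT_comp _ _ _ _ _ _ g) => //.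
    by apply: measurable_fun_pair => //; exact: measurable_funB.
  (* The two densities may differ at the end points, which form a null set. *)
  apply: eq_integral_itv_bounded; [exact: malloc|exact: malloc|].
  move=> x; rewrite in_itv/= => /andP[x0 xs]; congr (_ * _).
  by apply/le_anti/andP; split;
    apply: (@continuous_joint_density_le _ _ _ PX (X m) Sm) => //=; rewrite subr_gt0.
- move=> s _.
  rewrite -(reindex (fun n k => n%:R / (2 * beta) * erlang_ccdf k.+1 (2 * beta) s)); last first.
    move=> n k; rewrite mulr_ge0 ?divr_ge0 ?(ltW b2_gt0)// -lee_fin.
    by rewrite (@erlang_ccdfE _ b2).
  rewrite -(@tail_expectation_mixed _ b2 _ _ PX F c (fun i => p i m) r (X m) Sm s
    (mX m) mSm _ law).
    by rewrite (_ : S = fun w => X m w + Sm w)//; apply/funext => w; rewrite /S (bigD1 m).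
  have cdf0 : cdf (X m) 0 = 0%E.
    by rewrite X_marginal// eseries0// => n n1 _; rewrite (@erlang_cdf0 _ b)// mulr0.
  apply/eqP; rewrite eq_le measure_ge0 andbT -cdf0; apply: le_measure.
  - rewrite inE (_ : mkset _ = [set w | `]-oo, (0 : R)[%classic (X m w)]).
      by apply: measurable_preimage => //; exact: measurable_itv.
    by apply/seteqP; split => w /=; rewrite in_itv.
  - by rewrite inE; apply: measurable_preimage => //; exact: measurable_itv.
  - by move=> w /= /ltW; rewrite in_itv.
Qed.
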